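(* Let $\mathcal{Q}^{(l)}$ be the set of rooted labeled quadrangulations of the sphere (with at least one face) and $\mathcal{M}^{(l)}$ the set of rooted labeled planar maps (with at least one edge). The map $\Psi:\mathcal{Q}^{(l)}\to\mathcal{M}^{(l)}$ defined by Schaeffer's prescription is a bijection, and for every $Q\in\mathcal{Q}^{(l)}$: (i) the number of edges of $\Psi(Q)$ equals the number $N$ of faces of $Q$; (ii) the number of faces of $\Psi(Q)$ equals the number of local minima of the labeling of $Q$; (iii) the number of local maxima of the labeling of $\Psi(Q)$ equals the number of local maxima of the labeling of $Q$ (indeed the sets of local maxima coincide); (iv) the maximal label of $\Psi(Q)$ equals the maximal label of $Q$; (v) the minimal label of $\Psi(Q)$ equals the minimal label of $Q$ plus one; (vi) the label of the root vertex of $\Psi(Q)$ equals the larger of the two labels of the endpoints of the root edge of $Q$.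
   Context: A planar map is a connected multigraph (loops and multiple edges allowed) embedded in the oriented 2-sphere without edge crossings, considered up to orientation-preserving continuous deformation; faces, degrees and corners (sectors at a vertex between consecutive edges around a face) are as usual. A quadrangulation is a planar map all of whose faces have degree 4. $\mathcal{Q}^{(l)}$: quadrangulations with a marked unoriented edge (the root edge) and integer labels on the vertices such that labels differ by exactly one along every edge. $\mathcal{M}^{(l)}$: planar maps with a marked corner (the root corner; its vertex is the root vertex) and integer labels on the vertices such that labels differ by at most one along every edge. A local minimum (resp. maximum) of a labeling of a map is a vertex whose label is $\le$ (resp. $\ge$) the labels of all its neighbours. For $Q\in\mathcal{Q}^{(l)}$ each face has cyclic labels $(t-1,t,t+1,t)$ (simple) or $(t+1,t,t+1,t)$ (confluent). Schaeffer's prescription: inside each confluent face draw the diagonal joining its two corners labelled $t+1$; inside each simple face draw a new edge parallel to the side joining the corner labelled $t+1$ to the next corner of the face in clockwise order; discard the original edges, keep as vertices those incident to new edges, with their labels. $\Psi(Q)$ is the resulting labelled planar map, rooted at the corner of $\Psi(Q)$, at the endpoint $v$ of the root edge of $Q$ having the larger label, into which the root edge of $Q$ points. *)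

(* Defs.v *)
From HB Require Import structures.
From mathcomp Require Import all_boot all_order all_algebra.
Import Order.TTheory GRing.Theory Num.Theory.
Local Open Scope ring_scope.

(* A (labelled, rooted) map given by darts.  Only the darts in [ds] matter.
   [alpha] : the edge involution (opposite dart of the same edge);
   [rho]   : CLOCKWISE rotation of darts around their tail vertex
             (this fixes the orientation of the sphere);
   [lab d] : label of the tail vertex of [d];
   [rootd]  : root dart.  A dart [d] also stands for the corner at its tail
             vertex lying counterclockwise from [d] (between [d] and
             the counterclockwise-next dart around the vertex). *)
Record lmap := LMap {
  dart : finType;
  ds : {set dart};
  alpha : dart -> dart;
  rho : dart -> dart;
  lab : dart -> int;
  rootd : dart }.

Set Implicit Arguments. Unset Strict Implicit. Unset Printing Implicit Defensive.

(* face permutation: traverses each face counterclockwise (face on the left);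
   corner [d] belongs to the face (phi-orbit) of [d]. *)
Definition phi (M : lmap) (d : dart M) : dart M := rho M (alpha M d).

Definition norb (D : finType) (f : D -> D) (A : {set D}) : nat :=
  #|[set [set y in A | fconnect f x y] | x in A]|.

Definition nverts (M : lmap) : nat := norb (rho M) (ds M).
Definition nedges (M : lmap) : nat := norb (alpha M) (ds M).
Definition nfaces (M : lmap) : nat := norb (@phi M) (ds M).

Definition vert (M : lmap) (d : dart M) : {set dart M} :=
  [set y in ds M | fconnect (rho M) d y].

(* connected planar map (genus 0 by Euler's formula) *)
Definition is_map (M : lmap) : Prop :=
  rootd M \in ds M /\
  {in ds M, forall d, alpha M d \in ds M /\ alpha M d != d /\ alpha M (alpha M d) = d} /\
  {in ds M, forall d, rho M d \in ds M} /\
  {in ds M &, injective (rho M)} /\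
  {in ds M &, forall d e, connect (fun x y => (y == alpha M x) || (y == rho M x)) d e} /\
  (nverts M + nfaces M = nedges M + 2)%N.

Definition vertex_labels (M : lmap) : Prop :=
  {in ds M, forall d, lab M (rho M d) = lab M d}.

Definition is_quadrangulation (M : lmap) : Prop :=
  {in ds M, forall d, #|[set y | fconnect (@phi M) d y]| = 4%N}.

(* Q^(l) : rooted (root edge = edge of the root dart, unoriented) labelled
   quadrangulations *)
Definition isQl (M : lmap) : Prop :=
  is_map M /\ vertex_labels M /\ is_quadrangulation M /\
  {in ds M, forall d, `|lab M d - lab M (alpha M d)| = 1}.

(* M^(l) : rooted (root corner = root dart) labelled planar maps *)
Definition isMl (M : lmap) : Prop :=
  is_map M /\ vertex_labels M /\
  {in ds M, forall d, `|lab M d - lab M (alpha M d)| <= 1}.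

Definition iso_core (M1 M2 : lmap) (f : dart M1 -> dart M2) : Prop :=
  {in ds M1, forall d, f d \in ds M2} /\
  {in ds M1 &, injective f} /\
  (forall e, e \in ds M2 -> exists2 d, d \in ds M1 & f d = e) /\
  {in ds M1, forall d, f (alpha M1 d) = alpha M2 (f d)} /\
  {in ds M1, forall d, f (rho M1 d) = rho M2 (f d)} /\
  {in ds M1, forall d, lab M2 (f d) = lab M1 d}.

(* rooted at a corner: the root dart is preserved *)
Definition isoM (M1 M2 : lmap) : Prop :=
  exists f, iso_core f /\ f (rootd M1) = rootd M2.

(* rooted at an unoriented edge: the root edge is preserved *)
Definition isoQ (M1 M2 : lmap) : Prop :=
  exists f, iso_core f /\
    (f (rootd M1) = rootd M2 \/ f (rootd M1) = alpha M2 (rootd M2)).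

Definition locmin (M : lmap) (d : dart M) : bool :=
  [forall e, (e \in vert d) ==> (lab M d <= lab M (alpha M e))].
Definition locmax (M : lmap) (d : dart M) : bool :=
  [forall e, (e \in vert d) ==> (lab M (alpha M e) <= lab M d)].

Definition nlocmin (M : lmap) : nat := #|[set vert d | d in ds M & locmin d]|.
Definition nlocmax (M : lmap) : nat := #|[set vert d | d in ds M & locmax d]|.

Definition maxlab (M : lmap) : int :=
  \big[Order.max/lab M (rootd M)]_(d in ds M) lab M d.
Definition minlab (M : lmap) : int :=
  \big[Order.min/lab M (rootd M)]_(d in ds M) lab M d.

Definition pn (Q : lmap) (n : nat) (c : dart Q) : dart Q := iter n (@phi Q) c.
Arguments pn : clear implicits.

Definition confluent (Q : lmap) (c : dart Q) : bool :=
  (lab Q c == lab Q (pn Q 2 c)) && (lab Q (pn Q 1 c) == lab Q (pn Q 3 c)).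

(* in a simple face, c is the corner labelled t+1 *)
Definition maxcorner (Q : lmap) (c : dart Q) : bool :=
  lab Q (pn Q 2 c) + 2 == lab Q c.

(* corners of Q at which a new edge is drawn (= darts of Psi Q) *)
Definition sel (Q : lmap) (c : dart Q) : bool :=
  if confluent c then lab Q (pn Q 1 c) < lab Q c
  else maxcorner c || maxcorner (pn Q 1 c).
  (* in a simple face: the t+1 corner m, and the next corner clockwise
     (= pn Q 3 m), i.e. the corner c with pn Q 1 c = m *)

(* other endpoint (corner) of the new edge drawn in the face of c *)
Definition partner (Q : lmap) (c : dart Q) : dart Q :=
  if confluent c then pn Q 2 c
  else if maxcorner c then pn Q 3 c else pn Q 1 c.

Definition nextsel (Q : lmap) (c : dart Q) : dart Q :=
  let k := find (fun k => sel (iter k.+1 (rho Q) c)) (iota 0 #|dart Q|) in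
  iter k.+1 (rho Q) c.

(* rootd of Psi Q: the rootd edge, oriented towards its endpoint v of larger
   label, arrives at v as the dart d; the corner of Psi Q at v containing d
   is the first new dart clockwise strictly after d *)
Definition psi_root (Q : lmap) : dart Q :=
  nextsel (if lab Q (alpha Q (rootd Q)) < lab Q (rootd Q) then rootd Q
           else alpha Q (rootd Q)).

Definition Psi (Q : lmap) : lmap :=
  @LMap (dart Q) [set c in ds Q | sel c] (@partner Q) (@nextsel Q) (lab Q)
        (psi_root Q).

(* Main.v *)
Require Import Defs.
From HB Require Import structures.
From mathcomp Require Import all_boot all_order all_algebra.
From mathcomp Require Import zify.
Import Order.TTheory GRing.Theory Num.Theory.
Local Open Scope ring_scope.
Set Implicit Arguments. Unset Strict Implicit. Unset Printing Implicit Defensive.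

(** A corner of a face of [Q] carries a dart of [Psi Q] exactly when the label
    decreases from it to the preceding corner of the face, so the darts of
    [Psi Q] correspond to the edges of [Q], each edge being attached to its
    endpoint of larger label.

    Let [d] be a dart of [Q] going up from label [l].  By downward induction on
    [l] one shows that going around the face of [Psi Q] that contains the corner
    [phi d] without leaving the labels [>= l + 1], one reaches the corner of the
    preceding dart at the same vertex if that dart goes up, and otherwise the
    corner following the first descending dart, which has label [l]
    ([run_rotate], [run_nextsel]).  This uses neither planarity nor
    connectedness.  Following descents therefore leads from each face of
    [Psi Q] to exactly one local minimum of [Q], and conversely; hence
    [V(Psi Q) + F(Psi Q) = V(Q)], and Euler's formula holds for [Psi Q] if and
    only if it holds for [Q].

    The same statement says that an edge of [Q] joins a corner of [Psi Q] to the
    next corner of smaller label around its face (or to the local minimum inside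
    the face), which determines [Q] from [Psi Q] and dictates the inverse
    construction. *)

(** * First returns, orbits and face walks *)

Section FirstReturn.
Variables (T : finType) (f : T -> T).

(** Shaped so that [nextsel] is convertible to the first return of [rho] to [sel]. If the bounded
    search fails, the value is a meaningless iterate; hence the witnesses assumed below. *)
Definition first_return (P : pred T) (c : T) : T :=
  let k := find (fun k => P (iter k.+1 f c)) (iota 0 #|T|) in iter k.+1 f c.

Lemma iter_ltn_card n c y :
  y = iter n f c -> exists2 k, (k < #|T|)%N & y = iter k f c.
Proof.
move=> ->; have cy := fconnect_iter f n c.
exists (findex f c (iter n f c)); last by rewrite iter_findex.
by apply: leq_trans (findex_max cy) _; exact: max_card.
Qed.

Lemma first_returnP (P : pred T) c n : P (iter n.+1 f c) ->
  exists k, [/\ (k <= n)%N, first_return P c = iter k.+1 f c, P (iter k.+1 f c)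
    & forall j, (j < k)%N -> ~~ P (iter j.+1 f c)].
Proof.
move=> Pn; pose a k := P (iter k.+1 f c).
(* The iterates of [f c] repeat, so a witness exists below the bound of the search. *)
have [k0 ltk0 Pk0] : exists2 k, (k < #|T|)%N & a k.
  have [k ltk E] := @iter_ltn_card n (f c) _ erefl.
  by exists k => //; rewrite /a iterSr -E -iterSr.
have has_a : has a (iota 0 #|T|).
  by apply/hasP; exists k0; rewrite // mem_iota.
pose k := find a (iota 0 #|T|).
have ltk : (k < #|T|)%N by rewrite has_find size_iota in has_a.
have notP j : (j < k)%N -> ~~ P (iter j.+1 f c).
  move=> ltj; have := before_find 0%N ltj; rewrite nth_iota ?(ltn_trans ltj) //.
  by rewrite add0n /a => ->.
exists k; split=> //.
  by rewrite leqNgt; apply: contraL Pn; apply: notP.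
by have := nth_find 0%N has_a; rewrite nth_iota.
Qed.

Lemma first_return_eq (P : pred T) c n : P (iter n.+1 f c) ->
  (forall j, (j < n)%N -> ~~ P (iter j.+1 f c)) -> first_return P c = iter n.+1 f c.
Proof.
move=> Pn notP; have [k [lekn -> Pk _]] := first_returnP Pn.
suff -> : k = n by [].
by apply/eqP; rewrite eqn_leq lekn leqNgt; apply: contraL Pk; apply: notP.
Qed.

Lemma first_return1 (P : pred T) c : P (f c) -> first_return P c = f c.
Proof. by move=> Pc; rewrite (@first_return_eq P c 0). Qed.

Lemma first_returnS (P : pred T) c n : ~~ P (f c) -> P (iter n.+1 f c) ->
  first_return P c = first_return P (f c).
Proof.
move=> notP Pn; have [k [lekn -> Pk min_k]] := first_returnP Pn.
case: k => [|k] in lekn Pk min_k *; first by rewrite Pk in notP.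
rewrite [RHS](@first_return_eq P (f c) k) -?iterSr // => j ltj.
by rewrite -iterSr min_k.
Qed.

Lemma first_return_fconnect (P : pred T) c : fconnect f c (first_return P c).
Proof. exact: fconnect_iter. Qed.

Variable A : {pred T}.
Hypotheses (fA : {homo f : x / x \in A}) (injf : {in A &, injective f}).

Lemma fconnect_in x y : x \in A -> fconnect f x y -> y \in A.
Proof. by move=> Ax /iter_findex <-; apply: iter_in. Qed.

Lemma first_return_in P : {homo first_return P : x / x \in A}.
Proof. by move=> x; apply: iter_in. Qed.

Lemma fconnect_iterS x y : x \in A -> fconnect f x y -> exists n, y = iter n.+1 f x.
Proof.
move=> Ax /iter_findex <-; set n := findex _ _ _.
exists (n + (order f x).-1)%N.
by rewrite -addnS prednK ?order_gt0 // iterD (iter_order_in fA injf).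
Qed.

Lemma first_return_conn (P : pred T) x y : x \in A -> fconnect f x y -> P y ->
  exists k, [/\ first_return P x = iter k.+1 f x, P (iter k.+1 f x)
    & forall j, (j < k)%N -> ~~ P (iter j.+1 f x)].
Proof.
move=> Ax /(fconnect_iterS Ax)[n ->] /first_returnP[k [_ E Pk mk]].
by exists k.
Qed.

Lemma first_return_sat (P : pred T) x y :
  x \in A -> fconnect f x y -> P y -> P (first_return P x).
Proof. by move=> Ax xy /(first_return_conn Ax xy)[k [-> Pk _]]. Qed.

Lemma first_return_skip (P : pred T) x y : x \in A -> fconnect f x y -> P y ->
  ~~ P (f x) -> first_return P x = first_return P (f x).
Proof.
by move=> Ax /(fconnect_iterS Ax)[n ->] Pn notP; apply: first_returnS Pn.
Qed.

(** No point strictly between [x] and its first return satisfies [P], so the inverse walk from the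
    return meets [x] first. This makes the first return invertible on the points of [P]. *)
Lemma first_returnK (g : T -> T) (P : pred T) :
  {in A, cancel f g} -> {in A, cancel g f} -> {homo g : x / x \in A} ->
  forall x, x \in A -> P x ->
  first_return P x \in A /\
  (let h := fun k => iter k.+1 g (first_return P x) in
   exists k, [/\ h k = x & forall j, (j < k)%N -> ~~ P (h j)]).
Proof.
move=> fK gK gA x Ax Px; split; first exact: first_return_in.
have [k [-> Pk mk]] := first_return_conn Ax (connect0 _ x) Px.
have E j : (j <= k)%N -> iter j.+1 g (iter k.+1 f x) = iter (k - j) f x.
  move=> lejk; have -> : k.+1 = (j.+1 + (k - j))%N by rewrite addSn subnKC.
  rewrite iterD; elim: j {lejk} (iter _ _ _) (iter_in (k - j) fA Ax) => [|j IHj] z Az.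
    by rewrite /= fK.
  by rewrite iterSr [iter j.+2 f z]iterS fK ?IHj ?iter_in.
exists k; split; first by rewrite E // subnn.
move=> j ltjk; rewrite E 1?ltnW //.
by rewrite (_ : k - j = (k - j.+1).+1)%N; [apply: mk|]; lia.
Qed.

Lemma first_return_inj (P : pred T) :
  {in [pred x in A | P x] &, injective (first_return P)}.
Proof.
move=> x y /andP[/= Ax Px] /andP[/= Ay Py] E.
have K := @first_returnK _ P (finv_f_in fA injf) (f_finv_in fA injf)
            (finv_in fA).
have [_ [k [Ek mk]]] := K x Ax Px; have [_ [k' [Ek' mk']]] := K y Ay Py.
rewrite /= -E in Ek' mk'; rewrite /= in Ek mk.
case: (ltngtP k k') => [/mk'|/mk|kk'].
- by rewrite /= Ek Px.
- by rewrite /= Ek' Py.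
- by rewrite -Ek -Ek' kk'.
Qed.

(** A first return never jumps past [y], so it shortens the distance left to [y]. *)
Lemma fconnect_first_return (P : pred T) x y : x \in A -> P y ->
  fconnect f x y -> P x -> fconnect (first_return P) x y.
Proof.
move=> Ax Py /iter_findex; move: (findex f x y) => n.
elim: {n}_.+1 {-2}n (ltnSn n) x Ax => // N IHN [|n] leN x Ax E Px.
  by rewrite -E connect0.
have Pn : P (iter n.+1 f x) by rewrite E.
have [k [lekn Ek Pk _]] := first_returnP Pn.
apply: connect_trans (fconnect1 _ _) _; rewrite Ek.
apply: (IHN (n - k)%N) => //; first by lia.
- exact: iter_in.
- by rewrite -iterD -E; congr (iter _ _ _); lia.
Qed.

End FirstReturn.

(** * Orbits as a partition, and their number *)

Section Orbits.
Variables (T : finType) (f : T -> T) (A : {set T}).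
Hypotheses (fA : {homo f : x / x \in A}) (injf : {in A &, injective f}).

Definition cls (x : T) : {set T} := [set y in A | fconnect f x y].

Lemma fconnect_equiv_in : {in A & &, equivalence_rel (fconnect f)}.
Proof.
move=> x y z Ax Ay Az; split=> // xy; apply/idP/idP; last exact: connect_trans.
by apply: connect_trans; rewrite (fconnect_sym_in fA injf).
Qed.

Lemma cls_partition : partition [set cls x | x in A] A.
Proof. exact: equivalence_partitionP fconnect_equiv_in. Qed.

Lemma cls_refl x : x \in A -> x \in cls x.
Proof. by move=> Ax; rewrite inE Ax connect0. Qed.

Lemma eq_cls x y : x \in A -> y \in A -> (cls x == cls y) = fconnect f x y.
Proof.
move=> Ax Ay; apply/eqP/idP => [/setP/(_ y)|xy].
  by rewrite (cls_refl Ay) inE => /andP[].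
apply/setP=> z; rewrite !inE; case Az: (z \in A) => //=.
exact: (fconnect_equiv_in Ax Ay Az).2 xy.
Qed.

Lemma norb_uniform k :
  (forall x, x \in A -> #|[set y | fconnect f x y]| = k) -> #|A| = (norb f A * k)%N.
Proof.
move=> cardk; apply: card_uniform_partition cls_partition => _ /imsetP[x Ax ->].
rewrite -(cardk x Ax); apply: eq_card => y; rewrite !inE.
by case xy: (fconnect f x y); rewrite ?andbF // (fconnect_in fA Ax xy).
Qed.

End Orbits.

(** The two maps have the same fibres, so the set of pairs [(f x, g x)] projects bijectively onto
    both images. Used to compare orbit counts of different permutations. *)
Lemma eq_card_imset (aT rT rT' : finType) (f : aT -> rT) (g : aT -> rT')
    (A : {set aT}) :
  {in A &, forall x y, (f x == f y) = (g x == g y)} -> #|f @: A| = #|g @: A|.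
Proof.
move=> fg; pose P := [set (f x, g x) | x in A].
have -> : f @: A = fst @: P by rewrite -imset_comp.
have -> : g @: A = snd @: P by rewrite -imset_comp.
transitivity #|P|; [|apply/esym]; apply: card_in_imset;
  rewrite /P => X Y /imsetP[x Ax ->] /imsetP[y Ay ->] /= /eqP E.
  by rewrite (eqP E); move: E; rewrite fg // => /eqP ->.
by rewrite (eqP E); move: E; rewrite -fg // => /eqP ->.
Qed.

(** * Walks along a face above a given label *)

Section Run.
Variable M : lmap.

(** Only the corners strictly before [c'] are bounded below, so a run may end at the first corner of
    label below [l]; [run_uniq] rests on this. *)
Definition run (l : int) (c c' : dart M) : Prop :=
  exists2 k, c' = iter k (@phi M) c
    & forall j, (j < k)%N -> l <= lab M (iter j (@phi M) c).

Lemma run1 l c : l <= lab M c -> run l c (phi c).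
Proof. by move=> lc; exists 1%N => // -[]. Qed.

Lemma run_trans l c2 c1 c3 : run l c1 c2 -> run l c2 c3 -> run l c1 c3.
Proof.
case=> k -> H [k' -> H']; exists (k' + k)%N; first by rewrite iterD.
move=> j ltj; case: (ltnP j k) => [/H //|lekj].
have := H' (j - k)%N; rewrite -iterD subnK //; apply; lia.
Qed.

Lemma run_le l l' c c' : l' <= l -> run l c c' -> run l' c c'.
Proof. by move=> ll' [k E H]; exists k => // j /H; apply: le_trans. Qed.

Lemma run_fconnect l c c' : run l c c' -> fconnect (@phi M) c c'.
Proof. by case=> k -> _; apply: fconnect_iter. Qed.

Lemma run_uniq l c c1 c2 : run l c c1 -> run l c c2 ->
  lab M c1 < l -> lab M c2 < l -> c1 = c2.
Proof.
case=> k -> H [k' -> H'] l1 l2.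
case: (ltngtP k k') => [/H'|/H|-> //]; by rewrite leNgt ?l1 ?l2.
Qed.

End Run.

(** * Faces of a labelled quadrangulation *)

(* Neither connectedness nor the genus matters for the local analysis. *)
Record labelled_quad (Q : lmap) : Prop := LabelledQuad {
  alpha_ds : {in ds Q, forall d, alpha Q d \in ds Q};
  alpha_neq : {in ds Q, forall d, alpha Q d != d};
  alphaK : {in ds Q, involutive (alpha Q)};
  rho_ds : {in ds Q, forall d, rho Q d \in ds Q};
  rho_inj : {in ds Q &, injective (rho Q)};
  lab_rho : vertex_labels Q;
  phi4 : {in ds Q, forall d, pn Q 4 d = d};
  phi2_neq : {in ds Q, forall d, pn Q 2 d != d};
  lab_alpha : {in ds Q, forall d, `|lab Q d - lab Q (alpha Q d)| = 1} }.

Section Quad.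
Variables (Q : lmap) (quadQ : labelled_quad Q).

Notation alpha := (alpha Q).
Notation rho := (rho Q).
Notation lab := (lab Q).
Notation phi := (@phi Q).
Notation pn := (pn Q).
Notation ds := (ds Q).
Notation sel := (@sel Q).
Notation nextsel := (@nextsel Q).
Notation partner := (@partner Q).

Let aQ := alpha_ds quadQ.
Let rQ := rho_ds quadQ.
Let aK := alphaK quadQ.

Lemma phi_ds : {in ds, forall d, phi d \in ds}.
Proof. by move=> d Dd; rewrite rQ ?aQ. Qed.

Lemma pn_ds n : {in ds, forall d, pn n d \in ds}.
Proof. by move=> d Dd; apply: iter_in Dd => x; apply: phi_ds. Qed.

Lemma pn3_phi : {in ds, forall d, pn 3 (phi d) = d}.
Proof. by move=> d /(phi4 quadQ). Qed.

Lemma phi_pn3 : {in ds, forall d, phi (pn 3 d) = d}.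
Proof. by move=> d /(phi4 quadQ). Qed.

Lemma phi_inj : {in ds &, injective phi}.
Proof. by move=> x y Dx Dy E; rewrite -(pn3_phi Dx) E pn3_phi. Qed.

Lemma rho_phi : {in ds, forall d, rho d = phi (alpha d)}.
Proof. by move=> d Dd; rewrite /Defs.phi aK. Qed.

Lemma pn3_rho : {in ds, forall d, pn 3 (rho d) = alpha d}.
Proof. by move=> d Dd; rewrite rho_phi ?pn3_phi ?aQ. Qed.

(** Since [pn 3] inverts [phi], which is [rho] after [alpha], this inverts [rho]: it is the next
    dart counterclockwise. *)
Definition rinv d := alpha (pn 3 d).

Lemma rinv_ds : {in ds, forall d, rinv d \in ds}.
Proof. by move=> d Dd; rewrite aQ ?pn_ds. Qed.

Lemma rinvK : {in ds, cancel rinv rho}.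
Proof. by move=> d Dd; rewrite rho_phi ?rinv_ds // aK ?pn_ds // phi_pn3. Qed.

Lemma rhoK : {in ds, cancel rho rinv}.
Proof. by move=> d Dd; rewrite /rinv pn3_rho // aK. Qed.

Lemma lab_phi : {in ds, forall d, lab (phi d) = lab (alpha d)}.
Proof. by move=> d Dd; rewrite (lab_rho quadQ) ?aQ. Qed.

Lemma lab_phi1 : {in ds, forall d, `|lab d - lab (phi d)| = 1}.
Proof. by move=> d Dd; rewrite lab_phi ?(lab_alpha quadQ). Qed.

Lemma lab_face d : d \in ds ->
  [/\ `|lab d - lab (phi d)| = 1, `|lab (phi d) - lab (pn 2 d)| = 1,
      `|lab (pn 2 d) - lab (pn 3 d)| = 1 & `|lab (pn 3 d) - lab d| = 1].
Proof.
move=> Dd; split; first exact: lab_phi1.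
- exact: (lab_phi1 (pn_ds 1 Dd)).
- exact: (lab_phi1 (pn_ds 2 Dd)).
- by have := lab_phi1 (pn_ds 3 Dd); rewrite phi_pn3.
Qed.

Lemma lab_iter_rho n : {in ds, forall d, lab (iter n rho d) = lab d}.
Proof.
move=> d Dd; elim: n => //= n <-; rewrite (lab_rho quadQ) //.
by apply: iter_in Dd => x; apply: rQ.
Qed.

Lemma lab_vertex d e : d \in ds -> fconnect rho d e -> lab e = lab d.
Proof. by move=> Dd /iter_findex <-; apply: lab_iter_rho. Qed.

Definition desc (d : dart Q) := lab (alpha d) < lab d.

Lemma descE d : d \in ds -> desc d = (lab (phi d) < lab d).
Proof. by move=> Dd; rewrite /desc lab_phi. Qed.

Lemma asc_lab d : d \in ds -> ~~ desc d -> lab (alpha d) = lab d + 1.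
Proof. by move=> Dd; have := lab_alpha quadQ Dd; rewrite /desc; lia. Qed.

Lemma desc_lab d : d \in ds -> desc d -> lab (alpha d) = lab d - 1.
Proof. by move=> Dd; have := lab_alpha quadQ Dd; rewrite /desc; lia. Qed.

Lemma desc_alpha d : d \in ds -> desc (alpha d) = ~~ desc d.
Proof. by move=> Dd; have := lab_alpha quadQ Dd; rewrite /desc aK //; lia. Qed.

(** Over all label patterns of a face, both branches of the prescription select exactly the corners
    entered by an ascent. This uniform test attaches each new dart to one edge of [Q]. *)
Lemma selE d : d \in ds -> sel d = (lab (pn 3 d) < lab d).
Proof.
move=> Dd; have [h1 h2 h3 h4] := lab_face Dd.
rewrite /Defs.sel /confluent /maxcorner.
have -> : pn 2 (pn 1 d) = pn 3 d by [].
have -> : pn 1 d = phi d by [].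
case: ifP; lia.
Qed.

Lemma sel_rho d : d \in ds -> sel (rho d) = desc d.
Proof. by move=> Dd; rewrite selE ?rQ // pn3_rho // (lab_rho quadQ). Qed.

(** The alternatives are: the corner labelled t+1 of a simple face, a corner labelled t+1 of a
    confluent face, and the other end of the new edge in a simple face. Most local arguments split
    along them. *)
Lemma selP c : c \in ds -> sel c ->
  [\/ [/\ partner c = pn 3 c, lab (pn 3 c) = lab c - 1,
          lab (pn 2 c) = lab c - 2 & lab (phi c) = lab c - 1],
      [/\ partner c = pn 2 c, lab (pn 3 c) = lab c - 1,
          lab (pn 2 c) = lab c & lab (phi c) = lab c - 1]
    | [/\ partner c = phi c, lab (pn 3 c) = lab c - 1,
          lab (pn 2 c) = lab c & lab (phi c) = lab c + 1]].
Proof.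
move=> Dc; rewrite selE // => Sc; have [h1 h2 h3 h4] := lab_face Dc.
have : [\/ lab (pn 2 c) = lab c - 2, lab (pn 2 c) = lab c /\ lab (phi c) = lab c - 1
  | lab (pn 2 c) = lab c /\ lab (phi c) = lab c + 1].
  case: (ltP (lab (pn 2 c)) (lab c)) => ?; first by constructor 1; lia.
  by case: (ltP (lab (phi c)) (lab c)) => ?; [constructor 2 | constructor 3]; lia.
rewrite /Defs.partner /confluent /maxcorner.
have -> : pn 1 c = phi c by [].
case=> [E|[E E']|[E E']]; [constructor 1|constructor 2|constructor 3];
  split; rewrite ?E ?E' ?eqxx //; try lia; do ?case: ifP => //; lia.
Qed.

Definition sel_ds : {set dart Q} := Defs.ds (Psi Q).
Notation S := sel_ds.

Lemma SE c : (c \in S) = (c \in ds) && sel c.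
Proof. by rewrite inE. Qed.

Lemma S_ds : {subset S <= ds}.
Proof. by move=> c; rewrite SE => /andP[]. Qed.

Lemma S_sel c : c \in S -> sel c.
Proof. by rewrite SE => /andP[]. Qed.

Lemma S_lab c : c \in S -> lab (pn 3 c) < lab c.
Proof. by rewrite SE => /andP[Dc]; rewrite selE. Qed.

Lemma S_rho d : d \in ds -> desc d -> rho d \in S.
Proof. by move=> Dd dd; rewrite SE rQ // sel_rho. Qed.

Lemma S_phi d : d \in ds -> ~~ desc d -> phi d \in S.
Proof. by move=> Dd dd; rewrite S_rho ?aQ // desc_alpha. Qed.

Lemma partner_S : {in S, forall c, partner c \in S}.
Proof.
move=> c; rewrite SE => /andP[Dc Sc].
have [h1 h2 h3 h4] := lab_face Dc.
have [h1' h2' h3' h4'] := lab_face (pn_ds 2 Dc).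
have E3 : pn 3 (pn 3 c) = pn 2 c by apply: (pn3_phi (pn_ds 2 Dc)).
have E4 : pn 3 (pn 2 c) = phi c by apply: (pn3_phi (pn_ds 1 Dc)).
have E5 : pn 3 (phi c) = c by apply: pn3_phi.
have D1 := phi_ds Dc; have D2 := pn_ds 2 Dc; have D3 := pn_ds 3 Dc.
by case: (selP Dc Sc) => -[-> a1 a2 a3]; rewrite SE selE // ?D1 ?D2 ?D3 ?E3 ?E4 ?E5;
  lia.
Qed.

Lemma partnerK : {in S, involutive partner}.
Proof.
move=> c Sc; have := partner_S Sc; move: Sc; rewrite !SE.
move=> /andP[Dc Sc] /andP[Dpc Spc].
have E2 : pn 2 (phi c) = pn 3 c by [].
have E3 : pn 2 (pn 2 c) = c by apply: (phi4 quadQ).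
have E4 : pn 3 (phi c) = c by apply: pn3_phi.
have E5 : phi (pn 3 c) = c by apply: phi_pn3.
case: (selP Dc Sc) Dpc Spc => -[-> a1 a2 a3] Dpc Spc;
case: (selP Dpc Spc) => -[-> b1 b2 b3] //; move: b1 b2 b3; rewrite ?E2 ?E5 ?E3 ?E4; try lia.
by have -> : phi (pn 2 c) = pn 3 c by []; lia.
Qed.

Lemma partner_neq : {in S, forall c, partner c != c}.
Proof.
move=> c; rewrite SE => /andP[Dc Sc]; apply/eqP=> E.
case: (selP Dc Sc) => -[]; rewrite E => F; rewrite -?F; try lia.
by move: (phi2_neq quadQ Dc); rewrite -F eqxx.
Qed.

Let rI := rho_inj quadQ.

Lemma fconnect_rho_sym : {in ds &, forall d e, fconnect rho d e = fconnect rho e d}.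
Proof. exact: fconnect_sym_in rQ rI. Qed.

Lemma nextsel_desc d : d \in ds -> desc d -> nextsel d = rho d.
Proof. by move=> Dd dd; apply: (@first_return1 _ rho sel); rewrite sel_rho. Qed.

(** As [d] ascends, [rho d] is not selected and the search passes over it; the descending [e]
    guarantees that the search succeeds. *)
Lemma nextsel_asc d e : d \in ds -> ~~ desc d -> fconnect rho d e -> desc e ->
  nextsel d = nextsel (rho d).
Proof.
move=> Dd ad de be; apply: (first_return_skip rQ rI Dd (y := rho e)).
- by apply: connect_trans de _; apply: fconnect1.
- by rewrite sel_rho // (fconnect_in rQ Dd de).
- by rewrite sel_rho.
Qed.

Lemma nextsel_vertex d : d \in ds -> fconnect rho d (nextsel d).
Proof. by move=> Dd; apply: first_return_fconnect. Qed.

Lemma nextsel_ds d : d \in ds -> nextsel d \in ds.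
Proof. exact: first_return_in. Qed.

Lemma nextsel_S d e : d \in ds -> fconnect rho d e -> desc e -> nextsel d \in S.
Proof.
move=> Dd de be; rewrite SE nextsel_ds //=.
apply: (first_return_sat rQ rI Dd (y := rho e)).
  by apply: connect_trans de _; apply: fconnect1.
by rewrite sel_rho // (fconnect_in rQ Dd de).
Qed.

Lemma desc_rinv c : c \in S -> desc (rinv c).
Proof.
by rewrite SE => /andP[Dc Sc]; rewrite -sel_rho ?rinv_ds // rinvK.
Qed.

Lemma fconnect_rinv c : c \in ds -> fconnect rho c (rinv c).
Proof.
move=> Dc; rewrite fconnect_rho_sym ?rinv_ds //.
by rewrite -{2}(rinvK Dc) fconnect1.
Qed.

Lemma nextsel_in_S : {in S, forall c, nextsel c \in S}.
Proof.
by move=> c Sc; apply: nextsel_S (desc_rinv Sc); rewrite ?fconnect_rinv ?S_ds.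
Qed.

Lemma nextsel_inj : {in S &, injective nextsel}.
Proof.
move=> x y; rewrite !SE => Sx Sy; apply: (first_return_inj rQ rI); exact.
Qed.

Lemma nextsel_fconnect : {in S &, forall x y, fconnect nextsel x y = fconnect rho x y}.
Proof.
move=> x y Sx; rewrite SE => /andP[Dy Py]; apply/idP/idP => xy.
  have := S_ds Sx; move/iter_findex: xy => <-.
  elim: (findex _ _ _) => //= n IHn Dx; apply: connect_trans (IHn Dx) _.
  by apply/nextsel_vertex/iter_in => // z; apply: nextsel_ds.
move: Sx; rewrite SE => /andP[Dx Px].
exact: fconnect_first_return.
Qed.

Notation phiP := (@Defs.phi (Psi Q)).
Notation runP := (@run (Psi Q)).

Lemma phiP_S : {in S, forall c, phiP c \in S}.
Proof. by move=> c Sc; apply/nextsel_in_S/partner_S. Qed.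

Lemma phiP_inj : {in S &, injective phiP}.
Proof.
move=> x y Sx Sy /(nextsel_inj (partner_S Sx) (partner_S Sy)) E.
by rewrite -(partnerK Sx) -[RHS](partnerK Sy); exact: (congr1 partner E).
Qed.

Lemma lab_bounded : exists B, forall d, lab d <= B.
Proof.
exists (Posz (\max_d `|lab d|)) => d.
have : (`|lab d| <= \max_d `|lab d|)%N by exact: leq_bigmax.
by lia.
Qed.

(* Downward induction on the label of [d]: the first claim at label [l] uses
   the second one at label [l + 1]. *)
Lemma run_rotate_aux B n : (forall d, lab d <= B) ->
  (forall d, d \in ds -> B - lab d < n%:Z -> ~~ desc d -> ~~ desc (rinv d) ->
    runP (lab d + 1) (phi d) (phi (rinv d))) /\
  (forall d e, d \in ds -> B - lab d < n%:Z -> ~~ desc d -> fconnect rho d e ->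
    desc e -> runP (lab d + 1) (phi d) (nextsel d)).
Proof.
move=> leB; elim: n => [|n [_ IHn]].
  by split=> d; have := leB d; lia.
have rot d : d \in ds -> B - lab d < n.+1%:Z -> ~~ desc d -> ~~ desc (rinv d) ->
    runP (lab d + 1) (phi d) (phi (rinv d)).
  move=> Dd ltd ad ar.
  have [h1 h2 h3 h4] := lab_face Dd.
  have lphi : lab (phi d) = lab d + 1 by rewrite lab_phi // asc_lab.
  have lpn3 : lab (pn 3 d) = lab d + 1.
    have := desc_alpha (rinv_ds Dd); rewrite ar /rinv aK ?pn_ds //.
    by rewrite descE ?pn_ds // phi_pn3 //; lia.
  have D2 := pn_ds 2 Dd; have D3 := pn_ds 3 Dd; have D1 := phi_ds Dd.
  have S1 : phi d \in S by apply: S_phi.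
  have E1 : pn 3 (phi d) = d by apply: pn3_phi.
  have E2 : pn 2 (phi d) = pn 3 d by [].
  have E3 : phi (phi d) = pn 2 d by [].
  have E4 : phi (rinv d) = rho (pn 3 d) by rewrite rho_phi.
  have d3 : desc (pn 3 d) by rewrite descE // phi_pn3 //; lia.
  move: (S1); rewrite SE => /andP[_ /(selP D1)]; rewrite E1 E2 E3.
  (* With l the label of [d], the face has labels l, l+1, then l or l+2, then l+1. If confluent, one
     step in the face of [Psi Q] reaches [phi (rinv d)]; if simple, the first step climbs to the
     vertex labelled l+2. *)
  case=> -[p1 p2 p3 p4]; first by lia.
    have <- : phiP (phi d) = phi (rinv d) by rewrite E4 -nextsel_desc // -p1.
    by apply: run1; rewrite /= lphi.
  have am : lab (alpha (pn 2 d)) = lab d + 1.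
    by rewrite -lab_phi //; have -> : phi (pn 2 d) = pn 3 d by [].
  have dm : desc (pn 2 d) by rewrite /desc am; lia.
  have Ey : phiP (phi d) = phi (alpha (pn 2 d)).
    by rewrite -rho_phi // -nextsel_desc // -p1.
  have step : runP (lab d + 1) (phi d) (phiP (phi d)).
    by apply: run1; rewrite /= lphi.
  apply: run_trans step _; rewrite Ey.
  have Er : rho (alpha (pn 2 d)) = pn 3 d by [].
  (* The ascending dart [alpha (pn 2 d)] is followed clockwise by the descending [pn 3 d], so the
     second claim, one label higher, leads to [phi (rinv d)]. *)
  have <- : nextsel (alpha (pn 2 d)) = phi (rinv d).
    rewrite E4 (@nextsel_asc _ (pn 3 d)) ?aQ ?desc_alpha ?dm //.
      by rewrite Er nextsel_desc.
    by rewrite -Er fconnect1.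
  apply: run_le (IHn _ (pn 3 d) _ _ _ _ _); rewrite ?am ?aQ ?desc_alpha ?dm //; try lia.
  by rewrite -Er fconnect1.
split=> // d e Dd ltd ad de be.
have De : e \in ds by apply: fconnect_in Dd de; exact: rQ.
(* Induction on the number of clockwise steps from [e] to [d]: ascending predecessors of [d] are
   passed by the first claim. *)
rewrite fconnect_rho_sym // in de; move/iter_findex: de.
move: (findex _ _ _) => k; elim: k d Dd ltd ad => [|k IHk] d Dd ltd ad Ek.
  by rewrite -Ek be in ad.
have Dr : iter k rho e \in ds by apply: iter_in De; exact: rQ.
have Er : rinv d = iter k rho e by rewrite -Ek /= rhoK.
have lr : lab (rinv d) = lab d by rewrite Er -Ek !lab_iter_rho.
have rd : rho (rinv d) = d by apply: rinvK.
have [dr|ar] := boolP (desc (rinv d)); last first.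
  apply: run_trans (rot d Dd ltd ad ar) _; rewrite -lr.
  have -> : nextsel d = nextsel (rinv d).
    rewrite -{1}rd -(@nextsel_asc _ e) ?rinv_ds // fconnect_rho_sym ?rinv_ds //.
    by rewrite Er fconnect_iter.
  by apply: IHk; rewrite ?rinv_ds ?lr // Er.
have D1 := phi_ds Dd; have D3 := pn_ds 3 Dd.
have S1 : phi d \in S by apply: S_phi.
have lphi : lab (phi d) = lab d + 1 by rewrite lab_phi // asc_lab.
have E1 : pn 3 (phi d) = d by apply: pn3_phi.
have l3 : lab (pn 3 d) = lab d - 1.
  have := desc_lab (rinv_ds Dd) dr; rewrite lr => <-.
  by rewrite /rinv aK.
move: (S1); rewrite SE => /andP[_ /(selP D1)]; rewrite E1.
have -> : pn 2 (phi d) = pn 3 d by [].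
(* A descending [rinv d] makes [phi d] the maximum of a simple face, whose new edge ends at the
   corner [d]: one step suffices. *)
case=> -[p1 p2 p3 p4]; try lia.
have <- : phiP (phi d) = nextsel d by rewrite -[in RHS]p1.
by apply: run1; rewrite /= lphi.
Qed.

Lemma run_rotate d : d \in ds -> ~~ desc d -> ~~ desc (rho d) ->
  runP (lab d + 1) (phi (rho d)) (phi d).
Proof.
move=> Dd ad ar; have [B leB] := lab_bounded.
have leBd := leB (rho d).
have [H _] := @run_rotate_aux B (`|B - lab (rho d)|.+1)%N leB.
have := H (rho d); rewrite rhoK // (lab_rho quadQ) //; apply; rewrite ?rQ //.
by rewrite -(lab_rho quadQ) //; lia.
Qed.

Lemma run_nextsel d e : d \in ds -> ~~ desc d -> fconnect rho d e -> desc e ->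
  runP (lab d + 1) (phi d) (nextsel d).
Proof.
move=> Dd; have [B leB] := lab_bounded; have leBd := leB d.
have [_ H] := @run_rotate_aux B (`|B - lab d|.+1)%N leB.
by apply: H => //; lia.
Qed.

End Quad.

(** * Faces of [Psi Q] and local minima *)

Section QuadCount.
Variables (Q : lmap) (quadQ : labelled_quad Q).

Notation alpha := (alpha Q).
Notation rho := (rho Q).
Notation lab := (lab Q).
Notation phi := (@phi Q).
Notation pn := (pn Q).
Notation ds := (ds Q).
Notation sel := (@sel Q).
Notation nextsel := (@nextsel Q).
Notation partner := (@partner Q).
Notation S := (sel_ds Q).
Notation phiP := (@Defs.phi (Psi Q)).
Notation runP := (@run (Psi Q)).

Let aQ := alpha_ds quadQ.
Let rQ := rho_ds quadQ.
Let aK := alphaK quadQ.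
Let rI := rho_inj quadQ.

Lemma locmin_asc d e : d \in ds -> locmin d -> fconnect rho d e -> ~~ desc e.
Proof.
move=> Dd /forallP/(_ e) min_d de; rewrite /desc -leNgt (lab_vertex quadQ Dd de).
by move: min_d; rewrite inE (fconnect_in rQ Dd de) de.
Qed.

Lemma locmin_desc d : d \in ds -> ~~ locmin d -> exists2 e, fconnect rho d e & desc e.
Proof.
move=> Dd /forallPn[e]; rewrite negb_imply inE -ltNge => /andP[/andP[De de] lt_e].
by exists e; rewrite // /desc (lab_vertex quadQ Dd de).
Qed.

Lemma locminNP d e : d \in ds -> fconnect rho d e -> desc e -> locmin d = false.
Proof.
by move=> Dd de be; apply: contraTF be => min_d; apply: locmin_asc min_d de.
Qed.

Lemma vert_eq d e : d \in ds -> e \in ds -> (vert d == vert e) = fconnect rho d e.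
Proof. exact: (eq_cls rQ rI). Qed.

Lemma locmin_vertex d e : d \in ds -> fconnect rho d e -> locmin e = locmin d.
Proof.
move=> Dd de; have De := fconnect_in rQ Dd de.
apply: eq_forallb => x; rewrite (lab_vertex quadQ Dd de).
by have /eqP -> : vert d == vert e by rewrite vert_eq.
Qed.

Lemma asc_pn3 c : c \in S -> ~~ desc (pn 3 c).
Proof.
move=> Sc; have := desc_rinv quadQ Sc.
by rewrite /rinv desc_alpha ?(pn_ds quadQ) ?(S_ds Sc).
Qed.

(** From an ascending dart this crosses the first descending edge clockwise and stops on its
    reversal, an ascending dart one label lower. Local minima are fixed points. *)
Definition descent d := if locmin d then d else pn 3 (nextsel d).

Definition reach d (V : {set dart Q}) :=
  exists n, let w := iter n descent d in locmin w && (vert w == V).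

Lemma iter_descent_locmin n d : locmin d -> iter n descent d = d.
Proof. by move=> min_d; elim: n => //= n ->; rewrite /descent min_d. Qed.

(** The iteration is constant once it meets a local minimum, so the longer of two descents ends
    where the shorter does. *)
Lemma reach_uniq d V W : reach d V -> reach d W -> V = W.
Proof.
wlog suff H : V W / forall n k, locmin (iter n descent d) ->
    vert (iter n descent d) = V -> vert (iter (k + n) descent d) = W -> V = W.
  case=> n /andP[m1 /eqP e1] [n' /andP[m2 /eqP e2]].
  case: (leqP n n') => le_n.
    by apply: (H V W n (n' - n)%N) => //; rewrite subnK.
  by apply/esym/(H W V n' (n - n')%N) => //; rewrite subnK // ltnW.
by move=> n k mn; rewrite iterD (iter_descent_locmin k mn) => <- <-.
Qed.

Lemma reach_step d V : reach d V <-> reach (descent d) V.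
Proof.
split=> -[n]; last by rewrite /= -iterSr => H; exists n.+1.
case: n => [|n] H; last by exists n; rewrite -iterSr.
by exists 0%N; move: H => /= /andP[m e]; rewrite /descent m m.
Qed.

(** Both darts have the same next selected corner, hence the same descent; at a local minimum both
    stay at the same vertex. *)
Lemma reach_rho d V : d \in ds -> ~~ desc d -> ~~ desc (rho d) ->
  reach d V <-> reach (rho d) V.
Proof.
move=> Dd ad ar; have rd := fconnect1 rho d.
have Dr := rQ Dd.
have := locmin_vertex Dd rd; have [min_d|nmin_d] := boolP (locmin d) => min_r.
  have /eqP V_eq : vert d == vert (rho d) by rewrite vert_eq.
  by split=> -[n]; rewrite iter_descent_locmin // => H; exists 0%N; move: H;
    rewrite /= V_eq min_d min_r.
have [e de be] := locmin_desc Dd nmin_d.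
apply: iff_trans (reach_step _ _) _; apply: iff_trans (iff_sym (reach_step _ _)).
rewrite /descent min_r (negPf nmin_d).
by rewrite (nextsel_asc quadQ Dd ad de be).
Qed.

(** In the three cases of [selP], the ascents into [c] and into [phiP c] differ by a descent, by a
    rotation between ascending darts, or by both. *)
Lemma reach_phiP (c : dart Q) V : c \in S -> reach (pn 3 c) V <-> reach (pn 3 (phiP c)) V.
Proof.
move=> Sc; have Dc := S_ds Sc.
have D1 := phi_ds quadQ Dc; have D2 := pn_ds quadQ 2 Dc.
have D3 := pn_ds quadQ 3 Dc.
have a3 := asc_pn3 Sc; have d3 := desc_rinv quadQ Sc.
have Er : rho (alpha (pn 2 c)) = pn 3 c by [].
have Sc' : sel c by move: (Sc); rewrite SE => /andP[].
case: (selP quadQ Dc Sc') => -[p1 p2 p3 p4].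
- have nmin : locmin (pn 3 c) = false.
    have D3' := pn_ds quadQ 3 D3.
    have E : rho (rinv (pn 3 c)) = pn 3 c by apply: (rinvK quadQ).
    have Dri := rinv_ds quadQ D3.
    apply: (@locminNP _ (rinv (pn 3 c))) => //.
      by rewrite (fconnect_rho_sym quadQ) // -{2}E fconnect1.
    rewrite -(sel_rho quadQ) // E (selE quadQ) //.
    have -> : pn 3 (pn 3 c) = pn 2 c by apply: (pn3_phi quadQ D2).
    by lia.
  apply: iff_trans (reach_step _ _) _; rewrite /descent nmin.
  by have -> : phiP c = nextsel (pn 3 c) by rewrite -p1.
- have d2 : desc (pn 2 c).
    by rewrite (descE quadQ) //; have -> : phi (pn 2 c) = pn 3 c by []; lia.
  have -> : phiP c = rho (pn 2 c) by rewrite -(nextsel_desc quadQ) // -p1.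
  rewrite (pn3_rho quadQ) // -Er; apply: iff_sym; apply: reach_rho; rewrite ?aQ //.
  by rewrite (desc_alpha quadQ) ?d2.
- have d1 : desc (phi c).
    by rewrite (descE quadQ) //; have -> : phi (phi c) = pn 2 c by []; lia.
  have -> : phiP c = rho (phi c) by rewrite -(nextsel_desc quadQ) // -p1.
  rewrite (pn3_rho quadQ) //.
  have d2 : desc (pn 2 c).
    by rewrite (descE quadQ) //; have -> : phi (pn 2 c) = pn 3 c by []; lia.
  have Da := aQ D1; have aa : ~~ desc (alpha (phi c)).
    by rewrite (desc_alpha quadQ) ?d1.
  have Ea : rho (alpha (phi c)) = pn 2 c by [].
  have ra : fconnect rho (alpha (phi c)) (pn 2 c) by rewrite -Ea fconnect1.
  (* Here the new dart is the higher one: its descent is [alpha (pn 2 c)], which rotates to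
     [pn 3 c]. *)
  apply: iff_trans (iff_sym (reach_step _ _)); rewrite /descent (locminNP Da ra d2).
  rewrite (nextsel_asc quadQ Da aa ra d2) Ea (nextsel_desc quadQ) //.
  rewrite (pn3_rho quadQ) // -Er; apply: iff_sym; apply: reach_rho; rewrite ?aQ //.
  by rewrite (desc_alpha quadQ) ?d2.
Qed.

Lemma reach_face (c c' : dart Q) V : c \in S -> fconnect phiP c c' ->
  reach (pn 3 c) V <-> reach (pn 3 c') V.
Proof.
move=> Sc /iter_findex <-; elim: (findex _ _ _) => //= n ->.
by apply: reach_phiP; apply: iter_in Sc => x; apply: phiP_S.
Qed.

(** Induction on the label of [c]: unless the ascent into [c] starts at a local minimum,
    [run_nextsel] leads along the same face to a corner one label lower. *)
Lemma face_locmin (c : dart Q) : c \in S ->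
  exists d, [/\ d \in ds, locmin d & fconnect phiP c (phi d)].
Proof.
have [B leB] : exists B, forall d, B <= lab d.
  exists (- Posz (\max_d `|lab d|)) => d.
  have : (`|lab d| <= \max_d `|lab d|)%N by exact: leq_bigmax.
  by lia.
move En: `|lab c - B|%N => n; elim: n c En => [|n IHn] c En Sc;
  have D3 := pn_ds quadQ 3 (S_ds Sc); have Dc := S_ds Sc;
  have l3 : lab (pn 3 c) < lab c by move: Sc; rewrite SE => /andP[_]; rewrite (selE quadQ).
  by have := leB c; have := leB (pn 3 c); lia.
have [min3|nmin3] := boolP (locmin (pn 3 c)).
  by exists (pn 3 c); rewrite phi_pn3.
have [e de be] := locmin_desc D3 nmin3; have a3 := asc_pn3 Sc.
have Sn := nextsel_S quadQ D3 de be.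
have ln : lab (nextsel (pn 3 c)) = lab (pn 3 c).
  by rewrite (lab_vertex quadQ D3) // nextsel_vertex.
have [|//|d [Dd md cd]] := IHn (nextsel (pn 3 c)).
  by have := leB (pn 3 c); have [] := lab_face quadQ Dc; rewrite ln; lia.
exists d; split=> //; apply: connect_trans cd.
have := run_fconnect (run_nextsel quadQ D3 a3 de be).
by rewrite phi_pn3.
Qed.

Lemma phiP_sym : {in S &, forall x y, fconnect phiP x y = fconnect phiP y x}.
Proof. exact: (fconnect_sym_in (phiP_S quadQ) (phiP_inj quadQ)). Qed.

(** All darts at a local minimum ascend, so [run_rotate] passes from each to the next within a
    single face of [Psi Q], the one around the minimum. *)
Lemma phi_locmin_connect d e : d \in ds -> locmin d -> fconnect rho d e ->
  fconnect phiP (phi d) (phi e).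
Proof.
move=> Dd min_d /iter_findex <-; elim: (findex _ _ _) => [|n IHn] /=.
  exact: connect0.
set e' := iter _ _ _ in IHn *.
have de' : fconnect rho d e' by apply: fconnect_iter.
have De' := fconnect_in rQ Dd de'.
have ae' := locmin_asc Dd min_d de'.
have ar : ~~ desc (rho e').
  by apply: (locmin_asc Dd min_d); apply: connect_trans de' (fconnect1 _ _).
apply: connect_trans IHn _.
by rewrite phiP_sym ?(S_phi quadQ) ?rQ //; apply: run_fconnect (run_rotate quadQ _ _ _).
Qed.

Lemma nfaces_Psi : nfaces (Psi Q) = nlocmin Q.
Proof.
rewrite /nfaces /nlocmin /norb.
pose L := [set d in ds | locmin d].
have LP d : d \in L -> [/\ d \in ds, locmin d & phi d \in S].
  rewrite inE => /andP[Dd md]; split=> //; apply: S_phi => //.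
  exact: locmin_asc md (connect0 _ _).
transitivity #|[set cls phiP S (phi d) | d in L]|.
  congr #|pred_of_set _|; apply/setP=> X; apply/imsetP/imsetP=> -[].
    move=> c Sc ->; have [d [Dd md cd]] := face_locmin Sc.
    exists d; first by rewrite inE Dd.
    have [|_ _ Sd] := LP d; first by rewrite inE Dd.
    by apply/eqP; rewrite (eq_cls (phiP_S quadQ) (phiP_inj quadQ)).
  by move=> d /LP[_ _ Sd] ->; exists (phi d).
have -> : [set vert d | d in ds & locmin d] = [set vert d | d in L].
  by apply/setP=> X; apply/imsetP/imsetP=> -[d Ld ->]; exists d; move: Ld; rewrite ?inE.
apply: eq_card_imset => d e /LP[Dd md Sd] /LP[De me Se].
rewrite vert_eq // (eq_cls (phiP_S quadQ) (phiP_inj quadQ)) //.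
apply/idP/idP; last exact: phi_locmin_connect.
(* The minimum reached is constant along a face, so two minima with a common face coincide. *)
move=> de; rewrite -vert_eq //; apply/eqP/(@reach_uniq d).
  by exists 0%N; rewrite /= md eqxx.
have := reach_face (vert e) Sd de; rewrite !(pn3_phi quadQ) // => ->.
by exists 0%N; rewrite /= me eqxx.
Qed.

(** A vertex of [Q] has a selected corner exactly when it has a descending dart, that is, when it is
    not a local minimum. *)
Lemma nverts_Psi : (nverts (Psi Q) + nlocmin Q)%N = nverts Q.
Proof.
have -> : nverts (Psi Q) = #|[set @vert Q c | c in S]|.
  apply: eq_card_imset => x y Sx Sy.
  apply: etrans (eq_cls (nextsel_in_S quadQ) (nextsel_inj quadQ) Sx Sy) _.
  apply: etrans (nextsel_fconnect quadQ Sx Sy) _; apply/esym.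
  exact: vert_eq (@S_ds Q _ Sx) (@S_ds Q _ Sy).
rewrite /nlocmin /nverts /norb.
set V1 := [set @vert Q c | c in S]; set V2 := [set @vert Q d | d in ds & locmin d].
have <- : V1 :|: V2 = [set cls rho ds d | d in ds].
  apply/setP=> X; rewrite inE; apply/orP/imsetP.
    case=> /imsetP[d]; first by move=> Sd ->; exists d; rewrite ?S_ds.
    by rewrite inE => /andP[Dd _] ->; exists d.
  case=> d Dd ->; have [md|nmd] := boolP (locmin d).
    by right; apply/imsetP; exists d; rewrite ?inE ?Dd.
  have [e de be] := locmin_desc Dd nmd; have De := fconnect_in rQ Dd de.
  left; apply/imsetP; exists (rho e); first exact: S_rho.
  apply/eqP; change (vert d == vert (rho e)); rewrite vert_eq ?rQ //.
  exact: connect_trans de (fconnect1 _ _).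
apply/esym; rewrite cardsU (_ : V1 :&: V2 = set0) ?cards0 ?subn0 //.
apply/setP=> X; rewrite !inE; apply/negP=> /andP[/imsetP[c Sc ->]].
case/imsetP=> d /[!inE] /andP[Dd md] /eqP; rewrite vert_eq ?(S_ds Sc) //.
rewrite (fconnect_rho_sym quadQ) ?(S_ds Sc) // => dc.
have := locmin_asc Dd md (connect_trans dc (fconnect_rinv quadQ (S_ds Sc))).
by rewrite desc_rinv.
Qed.

End QuadCount.

(** * Edges, Euler characteristic and connectedness *)

Lemma isQl_labelled_quad Q : isQl Q -> labelled_quad Q.
Proof.
case=> -[_ [aQ [rQ [rI _]]]] [labr [quadQ lab1]].
have phQ : {in ds Q, forall d, phi d \in ds Q} by move=> d /aQ[? _]; apply: rQ.
have phI : {in ds Q &, injective (@phi Q)}.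
  move=> x y Dx Dy /rI; have [ax [_ eqx]] := aQ x Dx; have [ay [_ eqy]] := aQ y Dy.
  by move=> /(_ ax ay) E; rewrite -eqx E eqy.
split=> //; try by move=> d /aQ[? []].
  move=> d Dd; have := iter_order_in phQ phI Dd.
  by rewrite /order; have := quadQ d Dd; rewrite cardsE => ->.
move=> d Dd; apply/eqP=> E.
(* Otherwise the face would have at most two corners instead of four. *)
suff /subset_leq_card : [set y | fconnect (@phi Q) d y] \subset [set d; phi d].
  by rewrite (quadQ d Dd) cards2; case: eqP.
apply/subsetP=> y; rewrite inE => /iter_findex <-.
elim: (findex _ _ _) => /= [|n]; first by rewrite set21.
by case/set2P => ->; rewrite ?set22 // (_ : phi (phi d) = d) ?set21.
Qed.

Section QuadMap.
Variables (Q : lmap) (quadQ : labelled_quad Q).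

Notation alpha := (alpha Q).
Notation rho := (rho Q).
Notation lab := (lab Q).
Notation phi := (@phi Q).
Notation pn := (pn Q).
Notation ds := (ds Q).
Notation sel := (@sel Q).
Notation nextsel := (@nextsel Q).
Notation partner := (@partner Q).
Notation S := (sel_ds Q).
Notation phiP := (@Defs.phi (Psi Q)).
Notation runP := (@run (Psi Q)).

Let aQ := alpha_ds quadQ.
Let rQ := rho_ds quadQ.
Let aK := alphaK quadQ.
Let rI := rho_inj quadQ.

Lemma face_cases d e : d \in ds -> fconnect phi d e ->
  [\/ e = d, e = phi d, e = pn 2 d | e = pn 3 d].
Proof.
move=> Dd /iter_findex <-; elim: (findex _ _ _) => [|n IHn]; first by constructor 1.
case: IHn => /= ->; [constructor 2|constructor 3|constructor 4|constructor 1] => //.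
by rewrite -[LHS]/(pn 4 d) (phi4 quadQ).
Qed.

Lemma phi_neq d : d \in ds -> phi d != d.
Proof.
by move=> Dd; apply/eqP=> E; have := lab_phi1 quadQ Dd; rewrite E subrr.
Qed.

Lemma card_face d : d \in ds -> #|[set y | fconnect phi d y]| = 4%N.
Proof.
move=> Dd; have D1 := phi_ds quadQ Dd; have D2 := pn_ds quadQ 2 Dd.
have -> : [set y | fconnect phi d y] = [set x in [:: d; phi d; pn 2 d; pn 3 d]].
  apply/setP=> e; rewrite !inE; apply/idP/idP.
    by case/(face_cases Dd) => ->; rewrite eqxx ?orbT.
  by case/or4P=> /eqP ->; rewrite ?connect0 ?fconnect1 ?fconnect_iter.
rewrite cardsE; apply/card_uniqP => /=; rewrite !inE !negb_or.
have n0 : d != phi d by rewrite eq_sym phi_neq.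
have n1 : phi d != pn 2 d by rewrite eq_sym; apply: phi_neq D1.
have n2 : pn 2 d != pn 3 d by rewrite eq_sym; apply: phi_neq D2.
have n3 : d != pn 3 d by have := phi_neq (pn_ds quadQ 3 Dd); rewrite phi_pn3.
have m0 : d != pn 2 d by rewrite eq_sym (phi2_neq quadQ).
have m1 : phi d != pn 3 d by rewrite eq_sym; apply: phi2_neq D1.
by rewrite n0 n1 n2 n3 m0 m1.
Qed.

Lemma double_edges_faces : (nedges Q * 2 = nfaces Q * 4)%N.
Proof.
rewrite -(norb_uniform (phi_ds quadQ) (phi_inj quadQ) card_face).
have aI : {in ds &, injective alpha}.
  by move=> x y Dx Dy E; rewrite -(aK Dx) E aK.
rewrite -(norb_uniform aQ aI) // => d Dd.
have -> : [set y | fconnect alpha d y] = [set d; alpha d].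
  apply/setP=> e; rewrite !inE; apply/idP/idP.
    move/iter_findex <-; elim: (findex _ _ _) => [|n IHn]; first by rewrite eqxx.
    by case/orP: IHn => /eqP /= ->; rewrite ?aK // eqxx ?orbT.
  by case/orP=> /eqP ->; rewrite ?connect0 ?fconnect1.
by rewrite cards2 eq_sym (alpha_neq quadQ).
Qed.

Lemma partner_inj : {in S &, injective partner}.
Proof.
by move=> x y Sx Sy E; rewrite -(partnerK quadQ Sx) E (partnerK quadQ).
Qed.

(** Each face has exactly two selected corners, exchanged by [partner]; thus edges of [Psi Q] are
    faces of [Q]. *)
Lemma partner_fconnect : {in S &, forall x y, fconnect partner x y = fconnect phi x y}.
Proof.
move=> c c' Sc Sc'; have Dc := S_ds Sc; apply/idP/idP.
  move/iter_findex <-.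
  elim: (findex _ _ _) => [|n IHn]; first exact: connect0.
  apply: connect_trans IHn _; rewrite /=; set e := iter n _ _.
  have Se : e \in S by apply: iter_in Sc => x; apply: partner_S.
  have sel_e : sel e by move: Se; rewrite SE => /andP[].
  by case: (selP quadQ (S_ds Se) sel_e) => -[-> _ _ _];
    rewrite ?fconnect1 ?fconnect_iter.
have sel_c : sel c by move: Sc; rewrite SE => /andP[].
have := Sc'; rewrite SE => /andP[Dc']; rewrite (selE quadQ) // => ltc'.
move=> cc'.
suff [-> | ->] : c' = c \/ c' = partner c by [exact: connect0 | exact: fconnect1].
have D1 := phi_ds quadQ Dc; have D2 := pn_ds quadQ 2 Dc.
have E1 : pn 3 (phi c) = c by apply: pn3_phi.
have E2 : pn 3 (pn 2 c) = phi c by apply: (pn3_phi quadQ D1).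
have E3 : pn 3 (pn 3 c) = pn 2 c by apply: (pn3_phi quadQ D2).
move: ltc'; case: (selP quadQ Dc sel_c) => -[-> p2 p3 p4];
  case: (face_cases Dc cc') => ->; auto; rewrite ?E1 ?E2 ?E3; lia.
Qed.

(** Labels cannot fall three times in a row around a face of degree 4. *)
Lemma face_meets_S d : d \in ds -> exists2 c, c \in S & fconnect phi d c.
Proof.
move=> Dd; have [a|a] := boolP (desc d); last by exists (phi d); rewrite ?fconnect1 ?S_phi.
have D1 := phi_ds quadQ Dd; have D2 := pn_ds quadQ 2 Dd.
have [b|b] := boolP (desc (phi d)); last first.
  by exists (phi (phi d)); rewrite ?(S_phi quadQ) // (fconnect_iter _ 2).
have c : ~~ desc (pn 2 d).
  rewrite (descE quadQ) // in a; rewrite (descE quadQ) // in b.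
  rewrite (descE quadQ) //; have [h1 h2 h3 h4] := lab_face quadQ Dd.
  have E1 : phi (phi d) = pn 2 d by []; have E2 : phi (pn 2 d) = pn 3 d by [].
  by move: b; rewrite E1 E2; lia.
by exists (phi (pn 2 d)); rewrite ?(S_phi quadQ) // (fconnect_iter _ 3).
Qed.

Lemma nedges_Psi : nedges (Psi Q) = nfaces Q.
Proof.
transitivity #|[set cls phi ds c | c in S]|.
  apply: eq_card_imset => x y Sx Sy.
  apply: etrans (eq_cls (partner_S quadQ) partner_inj Sx Sy) _.
  apply: etrans (partner_fconnect Sx Sy) _; apply/esym.
  exact (eq_cls (phi_ds quadQ) (phi_inj quadQ) (@S_ds Q _ Sx) (@S_ds Q _ Sy)).
apply: eq_card => X; apply/imsetP/imsetP=> -[d Dd ->].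
  by exists d => //; apply: S_ds.
have [c Sc dc] := face_meets_S Dd; exists c => //; apply/eqP.
by rewrite (eq_cls (phi_ds quadQ) (phi_inj quadQ)) ?(S_ds Sc).
Qed.

(** As E(Q) = 2F(Q), both equations say V(Q) = F(Q) + 2. The converse direction serves the inverse
    construction. *)
Lemma euler_Psi : (nverts (Psi Q) + nfaces (Psi Q) = nedges (Psi Q) + 2)%N <->
  (nverts Q + nfaces Q = nedges Q + 2)%N.
Proof.
rewrite nedges_Psi (nfaces_Psi quadQ) (nverts_Psi quadQ).
by have := double_edges_faces; lia.
Qed.

(** * Connectedness of [Psi Q] *)

Definition dart_step (M : lmap) : rel (dart M) :=
  fun x y => (y == Defs.alpha M x) || (y == Defs.rho M x).

Notation conP := (connect (@dart_step (Psi Q))).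

Lemma conP_partner c : conP c (partner c).
Proof. by apply: connect1; rewrite /dart_step eqxx. Qed.

Lemma conP_nextsel c : conP c (nextsel c).
Proof. by apply: connect1; rewrite /dart_step eqxx orbT. Qed.

Lemma conP_face c c' : fconnect phiP c c' -> conP c c'.
Proof.
apply: connect_sub => x _ /eqP <-.
exact: connect_trans (conP_partner _) (conP_nextsel _).
Qed.

(** The corner just clockwise of the edge at its higher end; it identifies unoriented edges of [Q]
    with darts of [Psi Q]. *)
Definition edge_corner d := if desc d then rho d else phi d.

Lemma edge_corner_S d : d \in ds -> edge_corner d \in S.
Proof.
by move=> Dd; rewrite /edge_corner; case: ifPn => bd; [apply: S_rho | apply: S_phi].
Qed.

Lemma edge_corner_alpha d : d \in ds -> edge_corner (alpha d) = edge_corner d.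
Proof.
move=> Dd; rewrite /edge_corner (desc_alpha quadQ) // (rho_phi quadQ Dd).
by rewrite (rho_phi quadQ (aQ Dd)) aK //; case: (desc d).
Qed.

Lemma conP_edge_corner c : c \in S -> conP c (edge_corner c).
Proof.
move=> Sc; rewrite /edge_corner; have Dc := S_ds Sc; case: ifPn => bc.
  by rewrite -(nextsel_desc quadQ) //; apply: conP_nextsel.
have sel_c : sel c by move: Sc; rewrite SE => /andP[].
rewrite (descE quadQ) // in bc.
case: (selP quadQ Dc sel_c) => -[p1 p2 p3 p4]; try lia.
by rewrite -p1; apply: conP_partner.
Qed.

(** After a descending [d] one dart step suffices. After an ascending one, the runs join both
    corners within a face of [Psi Q], even at a local minimum, which is no vertex of [Psi Q]. *)
Lemma conP_edge_corner_rho d : d \in ds -> conP (edge_corner d) (edge_corner (rho d)).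
Proof.
move=> Dd; rewrite {1}/edge_corner; case: ifPn => ad.
  by apply/conP_edge_corner/S_rho.
rewrite /edge_corner; case: ifPn => ar.
  rewrite -(nextsel_desc quadQ) ?rQ // -(nextsel_asc quadQ Dd ad (fconnect1 _ _) ar).
  by apply: conP_face; apply: run_fconnect (run_nextsel quadQ Dd ad (fconnect1 _ _) ar).
apply: conP_face; rewrite (phiP_sym quadQ) ?(S_phi quadQ) ?rQ //.
exact: run_fconnect (run_rotate quadQ Dd ad ar).
Qed.

(** The step relation is not symmetric, so the way back along [nextsel] goes around its cycle. *)
Lemma conP_edge_corner_conv c : c \in S -> conP (edge_corner c) c.
Proof.
move=> Sc; rewrite /edge_corner; have Dc := S_ds Sc; case: ifPn => bc.
  rewrite -(nextsel_desc quadQ) //.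
  have : fconnect nextsel (nextsel c) c.
    rewrite (fconnect_sym_in (nextsel_in_S quadQ) (nextsel_inj quadQ)) ?fconnect1 //.
    exact: nextsel_in_S.
  by apply: connect_sub => x _ /eqP <-; apply: conP_nextsel.
have sel_c : sel c by move: Sc; rewrite SE => /andP[].
rewrite (descE quadQ) // in bc.
case: (selP quadQ Dc sel_c) => -[p1 p2 p3 p4]; try lia.
by rewrite -p1 -{2}(partnerK quadQ Sc); apply: conP_partner.
Qed.

Lemma connected_Psi :
  {in ds &, forall d e, connect (@dart_step Q) d e} -> {in S &, forall d e, conP d e}.
Proof.
move=> conQ c c' Sc Sc'.
apply: connect_trans (conP_edge_corner Sc) _.
apply: connect_trans (conP_edge_corner_conv Sc').
have /connectP[p] := conQ _ _ (S_ds Sc) (S_ds Sc').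
elim: p c {Sc} (S_ds Sc) => [|e p IHp] d Dd /=; first by move=> _ ->.
case/andP=> /orP de ep last_p.
have De : e \in ds by case: de => /eqP ->; rewrite ?aQ ?rQ.
apply: connect_trans (IHp e De ep last_p).
by case: de => /eqP ->; [rewrite edge_corner_alpha | apply: conP_edge_corner_rho].
Qed.

End QuadMap.

(** * Local maxima and extreme labels *)

Lemma le_maxlab M d : d \in ds M -> lab M d <= maxlab M.
Proof. by move=> Dd; apply: (le_bigmax_cond _ (lab M) Dd). Qed.

Lemma minlab_le M d : d \in ds M -> minlab M <= lab M d.
Proof. by move=> Dd; apply: (bigmin_le_cond _ (lab M) Dd). Qed.

Lemma maxlab_le M B : rootd M \in ds M ->
  (forall d, d \in ds M -> lab M d <= B) -> maxlab M <= B.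
Proof. by move=> Dr leB; apply: bigmax_le => *; apply: leB. Qed.

Lemma le_minlab M B : rootd M \in ds M ->
  (forall d, d \in ds M -> B <= lab M d) -> B <= minlab M.
Proof. by move=> Dr leB; apply: le_bigmin => *; apply: leB. Qed.

Section Extrema.
Variables (Q : lmap) (quadQ : labelled_quad Q).

Notation alpha := (alpha Q).
Notation rho := (rho Q).
Notation lab := (lab Q).
Notation phi := (@phi Q).
Notation pn := (pn Q).
Notation ds := (ds Q).
Notation sel := (@sel Q).
Notation nextsel := (@nextsel Q).
Notation partner := (@partner Q).
Notation S := (sel_ds Q).

Let aQ := alpha_ds quadQ.
Let rQ := rho_ds quadQ.
Let aK := alphaK quadQ.
Let rI := rho_inj quadQ.

Lemma locmax_desc d e : d \in ds -> locmax d -> fconnect rho d e -> desc e.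
Proof.
move=> Dd /forallP/(_ e) max_d de; have De := fconnect_in rQ Dd de.
apply: contraLR max_d => /(asc_lab quadQ De) ae.
by rewrite inE De de ae (lab_vertex quadQ Dd de) /= -ltNge; lia.
Qed.

Lemma locmax_asc d : d \in ds -> ~~ locmax d -> exists2 e, fconnect rho d e & ~~ desc e.
Proof.
move=> Dd /forallPn[e]; rewrite negb_imply inE -ltNge => /andP[/andP[De de] lt_e].
by exists e; rewrite // /desc -leNgt (lab_vertex quadQ Dd de) ltW.
Qed.

Lemma locmax_vertex d e : d \in ds -> fconnect rho d e -> locmax e = locmax d.
Proof.
move=> Dd de; have De := fconnect_in rQ Dd de.
apply: eq_forallb => x; rewrite (lab_vertex quadQ Dd de).
by have /eqP -> : vert d == vert e by rewrite (vert_eq quadQ).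
Qed.

Lemma locmax_S d : d \in ds -> locmax d -> d \in S.
Proof.
move=> Dd md; have dd := locmax_desc Dd md (fconnect_rinv quadQ Dd).
by have := S_rho quadQ (rinv_ds quadQ Dd) dd; rewrite rinvK.
Qed.

(** A new edge rises from a selected corner exactly when the dart of [Q] at that corner ascends. *)
Lemma locmax_Psi c : c \in S -> @locmax (Psi Q) c = @locmax Q c.
Proof.
move=> Sc; have Dc := S_ds Sc; apply/idP/idP => [maxP|maxQ].
  apply/contraT => /(locmax_asc Dc)[e ce ae].
  (* Clockwise from the descending [rinv c], some descent is directly followed by an ascent; the
     corner between them is selected and its new edge rises. *)
  have [j dj aj] : exists2 j, desc (iter j rho (rinv c)) & ~~ desc (iter j.+1 rho (rinv c)).
    have := connect_trans (fconnect1 rho (rinv c)).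
    rewrite (rinvK quadQ) // => /(_ e ce) /iter_findex.
    move: (findex _ _ _) ae => n ae E; rewrite -E in ae.
    elim: n ae {E} => [|n IHn] ae; first by rewrite /= (desc_rinv quadQ Sc) in ae.
    by have [dn|/IHn //] := boolP (desc (iter n rho (rinv c))); exists n.
  set f := iter j rho _ in dj aj.
  have Df : f \in ds by apply: iter_in; rewrite ?(rinv_ds quadQ).
  have Sr : rho f \in S by apply: S_rho.
  have cr : fconnect rho c (rho f).
    apply: connect_trans (fconnect_rinv quadQ Dc) _.
    by rewrite -[rho f]/(iter j.+1 rho (rinv c)) fconnect_iter.
  have : lab (partner (rho f)) <= lab c.
    by have := forallP maxP (rho f); rewrite inE (nextsel_fconnect quadQ) // cr Sr.
  have sel_r : sel (rho f) by move: Sr; rewrite SE => /andP[].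
  rewrite -(lab_vertex quadQ Dc cr).
  have {}aj : ~~ desc (rho f) := aj; rewrite (descE quadQ) ?rQ // in aj.
  by case: (selP quadQ (rQ Df) sel_r) => -[p1 p2 p3 p4]; rewrite ?p1; lia.
suff H (e : dart Q) : e \in S -> fconnect nextsel c e -> lab (partner e) <= lab c.
  by apply/forallP=> e; apply/implyP; rewrite inE => /andP[]; apply: H.
move=> Se; rewrite (nextsel_fconnect quadQ) // => ce.
have de := locmax_desc Dc maxQ ce.
have De := S_ds Se; rewrite (descE quadQ) // in de.
have sel_e : sel e by move: Se; rewrite SE => /andP[].
rewrite /= -(lab_vertex quadQ Dc ce).
by case: (selP quadQ De sel_e) => -[p1 p2 p3 p4]; rewrite ?p1; lia.
Qed.

Lemma nlocmax_Psi : nlocmax (Psi Q) = nlocmax Q.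
Proof.
pose L := [set d in S | @locmax Q d].
have -> : nlocmax Q = #|[set @vert Q d | d in L]|.
  apply: eq_card => X; apply/imsetP/imsetP=> -[d]; rewrite inE => /andP[Dd md] ->.
    by exists d => //; rewrite inE md andbT; apply: locmax_S.
  by exists d => //; rewrite inE md andbT S_ds.
have -> : nlocmax (Psi Q) = #|[set @vert (Psi Q) d | d in L]|.
  apply: eq_card => X; apply/imsetP/imsetP=> -[d]; rewrite inE => /andP[Dd md] ->;
    exists d => //; rewrite inE; apply/andP; split=> //.
    by rewrite -locmax_Psi.
  by rewrite locmax_Psi.
apply: eq_card_imset => x y; rewrite inE => /andP[Sx _]; rewrite inE => /andP[Sy _].
apply: etrans (eq_cls (nextsel_in_S quadQ) (nextsel_inj quadQ) Sx Sy) _.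
apply: etrans (nextsel_fconnect quadQ Sx Sy) _; apply/esym.
exact (vert_eq quadQ (@S_ds Q _ Sx) (@S_ds Q _ Sy)).
Qed.

Lemma locmax_Psi_vertex : {in ds, forall d, @locmax Q d <->
  exists2 e, e \in Defs.ds (Psi Q) & (e \in @vert Q d) && @locmax (Psi Q) e}.
Proof.
move=> d Dd; split=> [md|[e Se /andP[/[!inE] /andP[De de]]]].
  have Sd := locmax_S Dd md; exists d => //.
  by rewrite inE Dd connect0 locmax_Psi.
by rewrite locmax_Psi // (locmax_vertex Dd de).
Qed.

(** The lower bound serves the maximal label of [Psi Q], the upper bound the minimal one. *)
Lemma lab_edge_corner d : d \in ds ->
  lab d <= lab (edge_corner d) <= lab d + 1.
Proof.
move=> Dd; rewrite /edge_corner; case: ifPn => bd.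
  by rewrite (lab_rho quadQ) //; lia.
by rewrite (lab_phi quadQ) // (asc_lab quadQ) //; lia.
Qed.

Hypothesis root_ds : rootd Q \in ds.

Definition root_desc := if desc (rootd Q) then rootd Q else alpha (rootd Q).

Lemma root_desc_ds : root_desc \in ds.
Proof. by rewrite /root_desc; case: ifP; rewrite ?aQ. Qed.

Lemma desc_root_desc : desc root_desc.
Proof.
by rewrite /root_desc; case: ifPn => // ad; rewrite (desc_alpha quadQ) ?ad.
Qed.

Lemma psi_rootE : psi_root Q = rho root_desc.
Proof. by rewrite -(nextsel_desc quadQ) ?root_desc_ds ?desc_root_desc. Qed.

Lemma psi_root_S : psi_root Q \in S.
Proof. by rewrite psi_rootE; apply: S_rho; rewrite ?root_desc_ds ?desc_root_desc. Qed.

Lemma lab_psi_root : lab (psi_root Q) = Num.max (lab (rootd Q)) (lab (alpha (rootd Q))).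
Proof.
rewrite psi_rootE (lab_rho quadQ) ?root_desc_ds // /root_desc /desc.
by case: ifPn => h; lia.
Qed.

Lemma maxlab_Psi : maxlab (Psi Q) = maxlab Q.
Proof.
apply/le_anti/andP; split; apply: maxlab_le.
- exact: psi_root_S.
- by move=> c Sc; exact (le_maxlab (@S_ds Q _ Sc)).
- exact: root_ds.
- move=> d Dd; have /andP[h _] := lab_edge_corner Dd; apply: le_trans h _.
  exact: (@le_maxlab (Psi Q)) (edge_corner_S quadQ Dd).
Qed.

Lemma minlab_Psi : minlab (Psi Q) = minlab Q + 1.
Proof.
apply/le_anti/andP; split.
  rewrite -lerBlDr; apply: le_minlab root_ds _ => d Dd.
  have /andP[_ h] := lab_edge_corner Dd; rewrite lerBlDr; apply: le_trans h.
  exact: (@minlab_le (Psi Q)) (edge_corner_S quadQ Dd).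
apply: (@le_minlab (Psi Q)) psi_root_S _ => c Sc.
have h := minlab_le (pn_ds quadQ 3 (@S_ds Q _ Sc)).
have := S_lab quadQ Sc.
by move: h => /=; lia.
Qed.

Lemma isMl_Psi :
  {in ds &, forall d e, connect (@dart_step Q) d e} ->
  (nverts Q + nfaces Q = nedges Q + 2)%N -> isMl (Psi Q).
Proof.
move=> conQ eulerQ; split; first split.
- exact: psi_root_S.
- split.
    move=> c Sc; split; first exact (partner_S quadQ Sc).
    by split; [exact (partner_neq quadQ Sc) | exact (partnerK quadQ Sc)].
  split; first exact (nextsel_in_S quadQ).
  split; first exact (nextsel_inj quadQ).
  split; first exact (connected_Psi quadQ conQ).
  exact/(euler_Psi quadQ).
split=> c Sc; have Dc := @S_ds Q _ Sc.
  exact (lab_vertex quadQ Dc (nextsel_vertex Dc)).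
change (`|lab c - lab (partner c)| <= 1).
by case: (selP quadQ Dc (@S_sel Q _ Sc)) => -[-> p2 p3 p4]; lia.
Qed.

End Extrema.

(** * Isomorphisms *)

Arguments pn Q n c : simpl never.

(** * Darts of [Q] coded by darts of [Psi Q] *)

Section EdgeCorner.
Variables (Q : lmap) (quadQ : labelled_quad Q).

(** Inverse of the coding of [d] by the pair of [edge_corner d] and [desc d]. *)
Definition edge_dart (c : dart Q) (b : bool) := if b then rinv c else pn Q 3 c.

Lemma edge_dart_ds c b : c \in sel_ds Q -> edge_dart c b \in ds Q.
Proof.
by move=> /S_ds Dc; case: b; [apply: (rinv_ds quadQ) | apply: (pn_ds quadQ)].
Qed.

Lemma desc_edge_dart c b : c \in sel_ds Q -> desc (edge_dart c b) = b.
Proof. by case: b => Sc; [apply: (desc_rinv quadQ) | apply/negbTE/asc_pn3]. Qed.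

Lemma edge_cornerK d : d \in ds Q -> edge_dart (edge_corner d) (desc d) = d.
Proof.
move=> Dd; rewrite /edge_dart /edge_corner; case: (desc d).
  exact: (rhoK quadQ).
exact: (pn3_phi quadQ).
Qed.

Lemma edge_dartK c b : c \in sel_ds Q -> edge_corner (edge_dart c b) = c.
Proof.
move=> Sc; rewrite /edge_corner desc_edge_dart //; case: b => /=.
  exact: (rinvK quadQ (S_ds Sc)).
exact: (phi_pn3 quadQ (S_ds Sc)).
Qed.

Lemma alpha_edge_dart c b : c \in sel_ds Q -> alpha Q (edge_dart c b) = edge_dart c (~~ b).
Proof. by move=> /S_ds Dc; case: b => //; apply: (alphaK quadQ); apply: pn_ds. Qed.

Lemma lab_edge_dart c b : c \in sel_ds Q ->
  lab Q (edge_dart c b) = if b then lab Q c else lab Q c - 1.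
Proof.
move=> Sc; have Dc := S_ds Sc; case: b.
  by rewrite -(lab_rho quadQ) ?(rinv_ds quadQ) // rinvK.
by have := S_lab quadQ Sc; have [] := lab_face quadQ Dc; rewrite /edge_dart; lia.
Qed.

(** Only the last case of [selP] has a higher partner, and only there does [c] ascend; so descent at
    a selected corner is visible in [Psi Q]. *)
Lemma desc_S c : c \in sel_ds Q -> desc c = (lab Q (@partner Q c) <= lab Q c).
Proof.
move=> Sc; have Dc := S_ds Sc; rewrite (descE quadQ) //.
by case: (selP quadQ Dc (S_sel Sc)) => -[-> p2 p3 p4]; lia.
Qed.

End EdgeCorner.

Section Iso.
Variables (Q1 Q2 : lmap) (quad1 : labelled_quad Q1) (quad2 : labelled_quad Q2).

(** * From isomorphisms of quadrangulations to isomorphisms of their images *)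

Section Forward.
Variable f : dart Q1 -> dart Q2.
Hypothesis isof : iso_core f.

Let fD : {in ds Q1, forall d, f d \in ds Q2} := isof.1.
Let fI : {in ds Q1 &, injective f} := isof.2.1.
Let fS : forall e, e \in ds Q2 -> exists2 d, d \in ds Q1 & f d = e := isof.2.2.1.
Let fa : {in ds Q1, forall d, f (alpha Q1 d) = alpha Q2 (f d)} := isof.2.2.2.1.
Let fr : {in ds Q1, forall d, f (rho Q1 d) = rho Q2 (f d)} := isof.2.2.2.2.1.
Let fl : {in ds Q1, forall d, lab Q2 (f d) = lab Q1 d} := isof.2.2.2.2.2.

Lemma iso_phi : {in ds Q1, forall d, f (phi d) = phi (f d)}.
Proof. by move=> d Dd; rewrite /phi fr ?fa // (alpha_ds quad1). Qed.

Lemma iso_pn n : {in ds Q1, forall d, f (pn Q1 n d) = pn Q2 n (f d)}.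
Proof.
move=> d Dd; elim: n => //= n IHn.
by rewrite -[RHS]/(phi (pn Q2 n (f d))) -IHn -iso_phi ?(pn_ds quad1).
Qed.

Lemma iso_sel : {in ds Q1, forall d, sel (f d) = sel d}.
Proof.
move=> d Dd; rewrite (selE quad1) // (selE quad2) ?fD //.
by rewrite -iso_pn // !fl ?(pn_ds quad1).
Qed.

Lemma iso_partner : {in ds Q1, forall d, f (partner d) = partner (f d)}.
Proof.
move=> d Dd; rewrite /partner /confluent /maxcorner -!iso_pn // !fl ?(pn_ds quad1) //.
by do 2?case: ifP.
Qed.

(** The two searches have different bounds, the sizes of the two dart types, so exact return times
    are compared instead. *)
Lemma iso_nextsel : {in sel_ds Q1, forall d, f (nextsel d) = nextsel (f d)}.
Proof.
move=> c Sc; have Dc := S_ds Sc; have rQ := rho_ds quad1.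
have Dit k : iter k (rho Q1) c \in ds Q1 by apply: iter_in Dc.
have fit k : f (iter k (rho Q1) c) = iter k (rho Q2) (f c).
  by elim: k => //= k <-; rewrite fr.
have [k [E selk mink]] :=
  first_return_conn rQ (rho_inj quad1) Dc (connect0 _ c) (S_sel Sc).
rewrite [nextsel c]E fit; apply/esym; apply: (first_return_eq (P := @sel Q2)).
  by rewrite -fit iso_sel.
by move=> j /mink; rewrite -fit iso_sel.
Qed.

Lemma iso_desc : {in ds Q1, forall d, desc (f d) = desc d}.
Proof. by move=> d Dd; rewrite /desc -fa // !fl ?(alpha_ds quad1). Qed.

Lemma iso_core_Psi : @iso_core (Psi Q1) (Psi Q2) f.
Proof.
split; first by move=> c; rewrite !inE => /andP[Dc sc]; rewrite fD ?iso_sel.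
split; first by move=> x y Sx Sy; apply: fI (@S_ds Q1 _ Sx) (@S_ds Q1 _ Sy).
split.
  move=> e; rewrite inE => /andP[/fS[d Dd <-]]; rewrite iso_sel // => sd.
  by exists d; rewrite // inE Dd.
split; first by move=> c Sc; exact (iso_partner (@S_ds Q1 _ Sc)).
split; first exact iso_nextsel.
by move=> c Sc; exact (fl (@S_ds Q1 _ Sc)).
Qed.

Lemma iso_root_desc : rootd Q1 \in ds Q1 -> rootd Q2 \in ds Q2 ->
  f (rootd Q1) = rootd Q2 \/ f (rootd Q1) = alpha Q2 (rootd Q2) ->
  f (psi_root Q1) = psi_root Q2.
Proof.
move=> r1 r2 Er; rewrite (psi_rootE quad1) // (psi_rootE quad2) // fr ?(root_desc_ds quad1) //.
congr (rho Q2 _); rewrite /root_desc -iso_desc //.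
case: Er => Er; rewrite Er; first by case: ifP; rewrite ?fa ?Er.
rewrite (desc_alpha quad2) //; case: (desc _) => //=.
by rewrite fa // Er (alphaK quad2).
Qed.

End Forward.

(** * From isomorphisms of images back to quadrangulations *)

Section Backward.
Variable f : dart Q1 -> dart Q2.
Hypothesis isof : @iso_core (Psi Q1) (Psi Q2) f.

Let fD : {in sel_ds Q1, forall d, f d \in sel_ds Q2} := isof.1.
Let fI : {in sel_ds Q1 &, injective f} := isof.2.1.
Let fS : forall e, e \in sel_ds Q2 -> exists2 d, d \in sel_ds Q1 & f d = e := isof.2.2.1.
Let fa : {in sel_ds Q1, forall d, f (partner d) = partner (f d)} := isof.2.2.2.1.
Let fr : {in sel_ds Q1, forall d, f (nextsel d) = nextsel (f d)} := isof.2.2.2.2.1.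
Let fl : {in sel_ds Q1, forall d, lab Q2 (f d) = lab Q1 d} := isof.2.2.2.2.2.

(** [f] is controlled on selected corners only; the coding by [edge_dart] carries it to all
    darts. *)
Definition extend (d : dart Q1) : dart Q2 := edge_dart (f (edge_corner d)) (desc d).

Let fec d : d \in ds Q1 -> f (edge_corner d) \in sel_ds Q2.
Proof. by move=> Dd; apply: fD; apply: edge_corner_S. Qed.

Lemma extend_ds : {in ds Q1, forall d, extend d \in ds Q2}.
Proof. by move=> d Dd; apply: edge_dart_ds; rewrite ?fec. Qed.

Lemma extend_inj : {in ds Q1 &, injective extend}.
Proof.
move=> x y Dx Dy E; have := congr1 (@desc Q2) E.
rewrite !desc_edge_dart ?fec // => Ed.
have := congr1 (@edge_corner Q2) E; rewrite !edge_dartK ?fec // => /fI Ec.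
rewrite -(edge_cornerK quad1 Dx) -(edge_cornerK quad1 Dy) Ed Ec //;
  exact: edge_corner_S.
Qed.

Lemma extend_edge_dart c b : c \in sel_ds Q1 -> extend (edge_dart c b) = edge_dart (f c) b.
Proof. by move=> Sc; rewrite /extend edge_dartK ?desc_edge_dart. Qed.

Lemma extend_surj e : e \in ds Q2 -> exists2 d, d \in ds Q1 & extend d = e.
Proof.
move=> De; have [c Sc Ec] := fS (edge_corner_S quad2 De).
exists (edge_dart c (desc e)); first exact: edge_dart_ds.
by rewrite extend_edge_dart // Ec edge_cornerK.
Qed.

Lemma extend_alpha : {in ds Q1, forall d, extend (alpha Q1 d) = alpha Q2 (extend d)}.
Proof.
move=> d Dd; rewrite /extend alpha_edge_dart ?fec //.
by rewrite edge_corner_alpha ?(desc_alpha quad1).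
Qed.

Lemma extend_lab : {in ds Q1, forall d, lab Q2 (extend d) = lab Q1 d}.
Proof.
move=> d Dd; have Se := edge_corner_S quad1 Dd.
by rewrite -{2}(edge_cornerK quad1 Dd) !lab_edge_dart ?fec // fl.
Qed.

Let desc_f c : c \in sel_ds Q1 -> desc (f c) = desc c.
Proof.
move=> Sc; rewrite !desc_S ?fD // -fa // !fl //; exact: partner_S.
Qed.

(** For selected [c], [edge_corner c] is [nextsel c] or [partner c], and [f] commutes with both. *)
Lemma extend_S : {in sel_ds Q1, forall c, extend c = f c}.
Proof.
move=> c Sc; have Dc := S_ds Sc; have Dfc := S_ds (fD Sc).
rewrite /extend /edge_corner; case: ifPn => bc.
  by rewrite -(nextsel_desc quad1) // fr // nextsel_desc ?desc_f //= rhoK.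
rewrite /=; suff -> : f (phi c) = phi (f c) by rewrite pn3_phi.
have up (Q : lmap) (quadQ : labelled_quad Q) (x : dart Q) : x \in sel_ds Q -> ~~ desc x ->
    partner x = phi x.
  move=> Sx; have Dx := S_ds Sx; rewrite (descE quadQ) // => ax.
  by case: (selP quadQ Dx (S_sel Sx)) => -[p1 p2 p3 p4]; try lia.
by rewrite -(up _ quad1 _ Sc bc) fa // (up _ quad2) ?fD // desc_f.
Qed.

Let f_phi c : c \in sel_ds Q1 -> f (@phi (Psi Q1) c) = @phi (Psi Q2) (f c).
Proof.
by move=> Sc; rewrite -[RHS]/(nextsel (partner (f c))) -fa // -fr //; apply: partner_S.
Qed.

Let f_run l c c' : c \in sel_ds Q1 ->
  @run (Psi Q1) l c c' -> @run (Psi Q2) l (f c) (f c').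
Proof.
move=> Sc [k Ek Hk].
have Sit n : iter n (@phi (Psi Q1)) c \in sel_ds Q1.
  by apply: iter_in Sc => x; apply: phiP_S.
have fit n : f (iter n (@phi (Psi Q1)) c) = iter n (@phi (Psi Q2)) (f c).
  by elim: n => //= n <-; rewrite f_phi.
exists k; first by rewrite Ek fit.
by move=> j ltj; rewrite -fit /= fl //; apply: Hk.
Qed.

Let extend_phi_asc d : d \in ds Q1 -> ~~ desc d -> extend (phi d) = phi (extend d).
Proof.
move=> Dd ad; have Sp := S_phi quad1 Dd ad.
rewrite extend_S // /extend /edge_corner (negPf ad) /=.
by rewrite phi_pn3 // (S_ds (fD Sp)).
Qed.

(** The corner coding the edge of [phi d] is the first one of smaller label after [rho d] around the
    face of [Psi Q1]. This description is transported by [f], and [run_uniq] concludes. *)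
Let extend_phi_desc2 d : d \in ds Q1 -> desc d -> desc (phi d) ->
  extend (phi d) = phi (extend d).
Proof.
move=> Dd dd dp; have D1 := phi_ds quad1 Dd.
have [h1 h2 h3 h4] := lab_face quad1 Dd.
have l1 : lab Q1 (phi d) < lab Q1 d by rewrite -(descE quad1).
have l2 : lab Q1 (pn Q1 2 d) < lab Q1 (phi d) by rewrite (descE quad1) in dp.
have Sd : d \in sel_ds Q1 by rewrite SE Dd (selE quad1) //; lia.
have Sfd := fD Sd; have Dfd := S_ds Sfd.
have d2 : desc (f d) by rewrite desc_f.
have lp : lab Q2 (partner (f d)) < lab Q2 (f d).
  rewrite -fa // !fl //; last exact: partner_S.
  by case: (selP quad1 Dd (S_sel Sd)) => -[-> p2 p3 p4]; lia.
have dp2 : desc (phi (f d)).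
  rewrite (descE quad2) ?(phi_ds quad2) // -[phi (phi _)]/(pn Q2 2 (f d)).
  by move: lp; case: (selP quad2 Dfd (S_sel Sfd)) => -[-> p2 p3 p4]; lia.
rewrite (extend_S Sd); set e := f d in Sfd Dfd d2 lp dp2 *.
have turn (Q : lmap) (quadQ : labelled_quad Q) (x : dart Q) : x \in ds Q -> desc x ->
    desc (phi x) -> [/\ rho Q (phi x) \in sel_ds Q, lab Q (rho Q (phi x)) < lab Q (rho Q x)
      & @run (Psi Q) (lab Q (rho Q x)) (rho Q x) (rho Q (phi x))].
  move=> Dx dx dpx; have Dpx := phi_ds quadQ Dx; have Dax := alpha_ds quadQ Dx.
  have Ex : rho Q (alpha Q x) = phi x by [].
  have cx : fconnect (rho Q) (alpha Q x) (phi x) by rewrite -Ex fconnect1.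
  have ax : ~~ desc (alpha Q x) by rewrite (desc_alpha quadQ) ?dx.
  have := run_nextsel quadQ Dax ax cx dpx.
  rewrite (nextsel_asc quadQ Dax ax cx dpx) Ex (nextsel_desc quadQ) //.
  rewrite -(rho_phi quadQ) // (desc_lab quadQ) // subrK.
  rewrite (lab_rho quadQ Dx) (lab_rho quadQ Dpx) => rx.
  by split=> //; [exact: S_rho | rewrite -(descE quadQ)].
have [S1 lt1 run1] := turn _ quad1 _ Dd dd dp.
have [S2 lt2 run2] := turn _ quad2 _ Dfd d2 dp2.
have Sr := S_rho quad1 Dd dd.
have Er : f (rho Q1 d) = rho Q2 e.
  by rewrite -(nextsel_desc quad1) // fr // nextsel_desc.
have ler : lab Q2 (rho Q2 e) = lab Q1 (rho Q1 d) by rewrite -Er fl.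
rewrite /extend /edge_corner dp /=.
have -> : f (rho Q1 (phi d)) = rho Q2 (phi e).
  have := f_run Sr run1; rewrite Er -ler => run1'.
  by apply: (run_uniq run1' run2) => //=; rewrite fl // ler.
by rewrite rhoK // (phi_ds quad2).
Qed.

Let extend_phi d : d \in ds Q1 -> extend (phi d) = phi (extend d).
Proof.
move=> Dd; have [dd|ad] := boolP (desc d); last exact: extend_phi_asc.
have D1 := phi_ds quad1 Dd; have D2 := pn_ds quad1 2 Dd.
have D3 := pn_ds quad1 3 Dd.
have [d1|a1] := boolP (desc (phi d)); first exact: extend_phi_desc2.
have E1 := extend_phi_asc D1 a1.
have E4 : phi (pn Q1 3 d) = d by apply: phi_pn3.
have [h1 h2 h3 h4] := lab_face quad1 Dd.
have [d2|a2] := boolP (desc (pn Q1 2 d)); last first.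
  (* In this simple face the other three sides are settled; as the fourth power of [phi] is the
     identity, they force the remaining one. *)
  have E2 := extend_phi_asc D2 a2.
  have E3 : extend (phi (pn Q1 3 d)) = phi (extend (pn Q1 3 d)).
    have [d3|a3] := boolP (desc (pn Q1 3 d)); last exact: extend_phi_asc.
    by apply: extend_phi_desc2; rewrite ?E4.
  rewrite E4 in E3; rewrite E3 -[pn Q1 3 d]/(phi (pn Q1 2 d)) E2.
  rewrite -[pn Q1 2 d]/(phi (phi d)) E1.
  by rewrite -[RHS]/(pn Q2 4 _) (phi4 quad2) // extend_ds.
have l1 : lab Q1 d < lab Q1 (pn Q1 2 d) + 1.
  rewrite (descE quad1) // -leNgt in a1.
  by move: a1; rewrite -[phi (phi d)]/(pn Q1 2 d); rewrite (descE quad1) // in dd; lia.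
have a3 : ~~ desc (pn Q1 3 d).
  rewrite (descE quad1) // E4; rewrite (descE quad1) // in d2.
  by move: d2; rewrite -[phi (pn Q1 2 d)]/(pn Q1 3 d); rewrite (descE quad1) // in dd; lia.
have Sd : d \in sel_ds Q1 by rewrite -E4; apply: S_phi.
have Dfd := S_ds (fD Sd).
rewrite (descE quad1) // in dd.
case: (selP quad1 Dd (S_sel Sd)) => -[p1 p2 p3 p4]; try lia.
(* The face is confluent. Equal labels at both ends of the new edge force the confluent case in [Q2]
   too. *)
have : lab Q2 (partner (f d)) = lab Q2 (f d).
  by rewrite -fa // !fl ?p1 ?p3 // -p1; apply: partner_S.
rewrite {1}/extend /edge_corner (negPf a1) -[phi (phi d)]/(pn Q1 2 d) -p1 fa // extend_S //=.
case: (selP quad2 Dfd (S_sel (fD Sd))) => -[-> q2 q3 q4] ?; try lia.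
exact (pn3_phi quad2 (phi_ds quad2 Dfd)).
Qed.

Lemma iso_core_extend : iso_core extend.
Proof.
split; first exact: extend_ds.
split; first exact: extend_inj.
split; first exact: extend_surj.
split; first exact: extend_alpha.
split; last exact: extend_lab.
move=> d Dd; rewrite (rho_phi quad1) // extend_phi ?(alpha_ds quad1) //.
by rewrite extend_alpha // -(rho_phi quad2) ?extend_ds.
Qed.

Lemma extend_root : rootd Q1 \in ds Q1 -> rootd Q2 \in ds Q2 ->
  f (psi_root Q1) = psi_root Q2 ->
  extend (rootd Q1) = rootd Q2 \/ extend (rootd Q1) = alpha Q2 (rootd Q2).
Proof.
move=> r1 r2; rewrite (psi_rootE quad1) // (psi_rootE quad2) // => Er.
have D1 := root_desc_ds quad1 r1; have D2 := root_desc_ds quad2 r2.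
have : extend (root_desc Q1) = root_desc Q2.
  by rewrite /extend /edge_corner desc_root_desc //= Er rhoK.
rewrite /root_desc; case: ifP => _; case: ifP => _ //; rewrite ?extend_alpha //; auto.
  by move=> E; right; rewrite -E (alphaK quad2) ?extend_ds.
move=> /(congr1 (alpha Q2)); rewrite !(alphaK quad2) ?extend_ds //; auto.
Qed.

End Backward.
End Iso.

Lemma isoQ_isoM_Psi Q1 Q2 : isQl Q1 -> isQl Q2 ->
  isoQ Q1 Q2 <-> isoM (Psi Q1) (Psi Q2).
Proof.
move=> Q1l Q2l; have quad1 := isQl_labelled_quad Q1l.
have quad2 := isQl_labelled_quad Q2l.
have r1 := Q1l.1.1; have r2 := Q2l.1.1.
split=> -[f [isof rf]].
  exists f; split; first exact (iso_core_Psi quad1 quad2 isof).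
  exact (iso_root_desc quad1 quad2 isof r1 r2 rf).
exists (@extend Q1 Q2 f); split; first exact (iso_core_extend quad1 quad2 isof).
exact (extend_root quad1 quad2 isof r1 r2 rf).
Qed.

(** * The inverse construction *)

Arguments first_return {T} f P c : simpl never.

(** * Returns to a label along a face *)

Section WeakReturn.
Variables (T : finType) (A : {pred T}) (lab : T -> int).

Definition weak_return (f : T -> T) (c : T) := first_return f [pred x | lab x <= lab c] c.

(** Labels drop by at most one per step, so a walk not starting downwards returns at exactly the
    label of [c]. The inequality at [g r] allows the same lemma to run backwards, so the two returns
    are mutually inverse. *)
Lemma weak_returnP (f g : T -> T) c :
  {homo f : x / x \in A} -> {homo g : x / x \in A} ->
  {in A, cancel f g} -> {in A, cancel g f} ->
  {in A, forall x, `|lab x - lab (f x)| <= 1} ->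
  c \in A -> lab c <= lab (f c) ->
  let r := weak_return f c in
  [/\ r \in A, lab r = lab c, lab r <= lab (g r), weak_return g r = c
    & exists2 k, r = iter k.+1 f c & forall j, (j <= k)%N -> lab c <= lab (iter j f c)].
Proof.
move=> fA gA fK gK lab1 Ac lec r; pose P := [pred x | lab x <= lab c].
have fI : {in A &, injective f} by apply: can_in_inj fK.
have Pc : P c by rewrite /= lexx.
have [k [Er Pk mink]] := first_return_conn fA fI Ac (connect0 _ c) Pc.
rewrite -/(weak_return f c) -/r in Er.
have Ar : r \in A by rewrite Er iter_in.
have lek j : (j <= k)%N -> lab c <= lab (iter j f c).
  by case: j => // j /mink /=; rewrite -ltNge => /ltW.
have lr : lab r = lab c.
  apply/le_anti; rewrite Er [X in X && _]Pk /=.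
  case: k => [|k] in Er Pk mink lek *; first exact: lec.
  have := mink k (ltnSn k); have := lab1 _ (iter_in k.+1 fA Ac).
  by rewrite /=; lia.
have [_ [k' [Ek' mink']]] := first_returnK fA fI fK gK gA Ac Pc.
rewrite -/(weak_return f c) -/r in Ek' mink'.
split=> //; last by exists k.
  case: k' Ek' mink' => [/= -> _|k' _ /(_ 0%N isT) /=]; first by rewrite lr.
  by rewrite lr -ltNge => /ltW.
rewrite -[RHS]Ek'; apply: first_return_eq; rewrite ?Ek' /= lr //.
Qed.

End WeakReturn.
Arguments weak_return {T} lab f c : simpl never.

Lemma norb_iso (T1 T2 : finType) (g1 : T1 -> T1) (g2 : T2 -> T2)
    (A1 : {set T1}) (A2 : {set T2}) (f : T1 -> T2) :
  {homo g1 : x / x \in A1} -> {in A1 &, injective g1} ->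
  {homo g2 : x / x \in A2} -> {in A2 &, injective g2} ->
  {in A1, forall x, f x \in A2} -> {in A1 &, injective f} ->
  (forall y, y \in A2 -> exists2 x, x \in A1 & f x = y) ->
  {in A1, forall x, f (g1 x) = g2 (f x)} -> norb g1 A1 = norb g2 A2.
Proof.
move=> g1A g1I g2A g2I fA fI fS fg.
have -> : norb g2 A2 = #|[set cls g2 A2 (f x) | x in A1]|.
  apply: eq_card => X; apply/imsetP/imsetP=> -[x Ax ->].
    by have [y Ay <-] := fS x Ax; exists y.
  by exists (f x); rewrite ?fA.
apply: eq_card_imset => x y Ax Ay.
apply: etrans (eq_cls g1A g1I Ax Ay) _.
rewrite (eq_cls g2A g2I) ?fA //.
have fit n : f (iter n g1 x) = iter n g2 (f x).
  by elim: n => //= n <-; rewrite fg // (iter_in n g1A Ax).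
apply/idP/idP => /iter_findex E; first by rewrite -E fit fconnect_iter.
rewrite -fit in E; move/fI: E => /(_ (iter_in _ g1A Ax) Ay) <-.
exact: fconnect_iter.
Qed.

(** * The quadrangulation built from a map *)

Section Inverse.
Variables (M : lmap).
Hypotheses (aM : {in ds M, forall d, alpha M d \in ds M})
  (aneq : {in ds M, forall d, alpha M d != d})
  (aK : {in ds M, involutive (alpha M)})
  (rM : {in ds M, forall d, rho M d \in ds M})
  (rI : {in ds M &, injective (rho M)})
  (labr : vertex_labels M)
  (lab1 : {in ds M, forall d, `|lab M d - lab M (alpha M d)| <= 1}).

Notation alpha := (alpha M).
Notation rho := (rho M).
Notation lab := (lab M).
Notation phi := (@phi M).
Notation phiV := (finv phi).
Notation ds := (ds M).

Let phiM : {homo phi : d / d \in ds}.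
Proof. by move=> d Dd; rewrite rM ?aM. Qed.

Lemma phi_inj_map : {in ds &, injective phi}.
Proof.
move=> x y Dx Dy /(rI (aM Dx) (aM Dy)) E.
by rewrite -(aK Dx) E aK.
Qed.

Let phiVM : {homo phiV : d / d \in ds}. Proof. exact: finv_in. Qed.
Let phiK : {in ds, cancel phi phiV} := finv_f_in phiM phi_inj_map.
Let phiVK : {in ds, cancel phiV phi} := f_finv_in phiM phi_inj_map.

Let lab_phi : {in ds, forall d, lab (phi d) = lab (alpha d)}.
Proof. by move=> d Dd; rewrite labr ?aM. Qed.

Let lab_phi1 : {in ds, forall d, `|lab d - lab (phi d)| <= 1}.
Proof. by move=> d Dd; rewrite lab_phi ?lab1. Qed.

Let lab_phiV1 : {in ds, forall d, `|lab d - lab (phiV d)| <= 1}.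
Proof. by move=> d Dd; have := lab_phi1 (phiVM Dd); rewrite phiVK // distrC. Qed.

Notation nextle := (weak_return lab phi).
Notation prevle := (weak_return lab phiV).

Let nextleP c : c \in ds -> lab c <= lab (phi c) ->
  [/\ nextle c \in ds, lab (nextle c) = lab c, lab (nextle c) <= lab (phiV (nextle c)),
      prevle (nextle c) = c
    & exists2 k, nextle c = iter k.+1 phi c
      & forall j, (j <= k)%N -> lab c <= lab (iter j phi c)].
Proof. exact: weak_returnP. Qed.

Let prevleP c : c \in ds -> lab c <= lab (phiV c) ->
  [/\ prevle c \in ds, lab (prevle c) = lab c, lab (prevle c) <= lab (phi (prevle c))
    & nextle (prevle c) = c].
Proof. by move=> Dc lec; case: (weak_returnP phiVM phiM phiVK phiK lab_phiV1 Dc lec). Qed.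

(* The dart [(c, true)] is the edge of the quadrangulation that leaves the
   corner [c] of [M] towards a vertex of label [lab c - 1]: the next corner of
   that label around the face, or a new vertex inside the face if there is
   none.  [(c, false)] is the opposite dart. *)
Definition quad_phi (x : dart M * bool) : dart M * bool :=
  let: (c, b) := x in
  if b then
    if lab (phiV c) < lab c then (nextle (phiV c), true) else (prevle c, false)
  else if lab c < lab (alpha c) then (alpha c, false) else (rho c, true).

(** [rho] is derived from the prescribed face permutation; vertices, including the new minimum
    inside each face of [M], exist only as its cycles. *)
Definition quad_of_map : lmap :=
  @LMap (dart M * bool)%type [set x | x.1 \in ds] (fun x => (x.1, ~~ x.2))
    (fun x => quad_phi (x.1, ~~ x.2))
    (fun x => if x.2 then lab x.1 else lab x.1 - 1) (rootd M, true).

Notation Q := quad_of_map.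

Lemma quad_phiE (x : dart Q) : Defs.phi x = quad_phi x.
Proof. by case: x => c b; rewrite /Defs.phi /= negbK. Qed.

Lemma quad_dsE (x : dart Q) : (x \in Defs.ds Q) = (x.1 \in ds).
Proof. by rewrite inE. Qed.

(** With t+1 the label of [m], this is the face drawn around its edge, with labels t, t+1, t, t-1 in
    this order. *)
Lemma quad_phi_simple m : m \in ds -> lab (alpha m) < lab m ->
  let x := nextle (alpha m) in
  [/\ x \in ds, lab x = lab (alpha m) &
      [/\ quad_phi (m, false) = (rho m, true), quad_phi (rho m, true) = (x, true),
          quad_phi (x, true) = (alpha m, false)
        & quad_phi (alpha m, false) = (m, false)]].
Proof.
move=> Dm ltm x; have Da := aM Dm.
have Ep : phi (alpha m) = rho m by rewrite /Defs.phi aK.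
have lr := labr Dm.
have := nextleP Da; rewrite Ep lr => /(_ (ltW ltm))[Dx lx lex px _].
have EV : phiV (rho m) = alpha m by rewrite -Ep phiK.
split=> //; split=> /=.
- by rewrite ltNge (ltW ltm).
- by rewrite EV lr ltm.
- by rewrite ltNge lex /= px.
- by rewrite aK // ltm.
Qed.

(** Half of a confluent face; the other half is the same statement at [alpha c]. *)
Lemma quad_phi_confluent c : c \in ds -> lab (alpha c) = lab c ->
  quad_phi (c, false) = (rho c, true) /\ quad_phi (rho c, true) = (alpha c, false).
Proof.
move=> Dc eqc; have Da := aM Dc.
have EV : phiV (rho c) = alpha c by rewrite -[in LHS](aK Dc) -/(phi (alpha c)) phiK.
rewrite /= eqc ltxx EV labr // eqc ltxx; split=> //; congr pair.
by rewrite /weak_return first_return1 EV //= labr // eqc.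
Qed.

(** Each dart lies on the face drawn around some edge of [M], so [quad_phi] can be studied on the
    two kinds of cycles above. *)
Lemma quad_cases (x : dart Q) : x \in Defs.ds Q ->
  (exists m, [/\ m \in ds, lab (alpha m) < lab m &
    [\/ x = (m, false), x = (rho m, true), x = (nextle (alpha m), true)
      | x = (alpha m, false)]]) \/
  (exists c, [/\ c \in ds, lab (alpha c) = lab c & x = (c, false) \/ x = (rho c, true)]).
Proof.
case: x => c b; rewrite quad_dsE /= => Dc; case: b; last first.
  case: (ltgtP (lab (alpha c)) (lab c)) => ltc.
  - by left; exists c; split=> //; constructor 1.
  - left; exists (alpha c); rewrite aM // aK //; split=> //; by constructor 4.
  - by right; exists c; split=> //; left.
have Da := phiVM Dc; have E := phiVK Dc.
have Er : rho (alpha (phiV c)) = c by [].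
have la : lab (alpha (phiV c)) = lab c by rewrite -lab_phi // E.
case: (ltgtP (lab (phiV c)) (lab c)) => ltc.
- left; exists (alpha (phiV c)); rewrite aM // aK // la; split=> //.
  by constructor 2; rewrite Er.
(* The edge sought is the first side of the walk from [prevle c] to [c]; it rises, since otherwise
   [phiV c] would be [prevle c], which is no higher than [c]. *)
- have [Dp lp lep np] := prevleP Dc (ltW ltc).
  left; exists (alpha (prevle c)); rewrite aM // aK // np -lab_phi // lp; split=> //.
    rewrite lt_neqAle -{2}lp lep andbT; apply/eqP=> eqp.
    have Eph : nextle (prevle c) = phi (prevle c).
      by apply: first_return1; rewrite /= lp -eqp.
    have Ec : phiV c = prevle c by rewrite -{1}np Eph phiK.
    by rewrite Ec lp ltxx in ltc.
  by constructor 3.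
- right; exists (alpha (phiV c)); rewrite aM // aK // la; split=> //.
  by right; rewrite Er.
Qed.

Lemma quad_phi_ds x : x \in Defs.ds Q -> quad_phi x \in Defs.ds Q.
Proof.
case/quad_cases=> [[m [Dm ltm]]|[c [Dc eqc]]].
  have [Dx lx [E1 E2 E3 E4]] := quad_phi_simple Dm ltm.
  by case=> ->; rewrite ?E1 ?E2 ?E3 ?E4 quad_dsE /= ?Dx ?rM ?aM.
have [E1 E2] := quad_phi_confluent Dc eqc.
by case=> ->; rewrite ?E1 ?E2 quad_dsE /= ?rM ?aM.
Qed.

Let confluent_swap c : c \in ds -> lab (alpha c) = lab c ->
  alpha c \in ds /\ lab (alpha (alpha c)) = lab (alpha c).
Proof. by move=> Dc eqc; rewrite aM // aK. Qed.

Lemma quad_phi4 x : x \in Defs.ds Q -> quad_phi (quad_phi (quad_phi (quad_phi x))) = x.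
Proof.
case/quad_cases=> [[m [Dm ltm]]|[c [Dc eqc]]].
  have [Dx lx [E1 E2 E3 E4]] := quad_phi_simple Dm ltm.
  by case=> ->; do 4?[rewrite E1 || rewrite E2 || rewrite E3 || rewrite E4].
have [E1 E2] := quad_phi_confluent Dc eqc.
have [Da eqa] := confluent_swap Dc eqc.
have [E3 E4] := quad_phi_confluent Da eqa; rewrite aK // in E4.
by case=> ->; do 4?[rewrite E1 || rewrite E2 || rewrite E3 || rewrite E4].
Qed.

Lemma quad_phi2_neq x : x \in Defs.ds Q -> quad_phi (quad_phi x) != x.
Proof.
case/quad_cases=> [[m [Dm ltm]]|[c [Dc eqc]]].
  have [Dx lx [E1 E2 E3 E4]] := quad_phi_simple Dm ltm.
  by case=> ->; do 2?[rewrite E1 || rewrite E2 || rewrite E3 || rewrite E4];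
    apply/eqP=> -[].
have [E1 E2] := quad_phi_confluent Dc eqc.
have [Da eqa] := confluent_swap Dc eqc.
have [E3 E4] := quad_phi_confluent Da eqa; rewrite aK // in E4.
case=> ->; rewrite ?E1 ?E2 ?E3; apply/eqP=> -[] E; first by have := aneq Dc; rewrite E eqxx.
by have := aneq Dc; rewrite (rI Da Dc E) eqxx.
Qed.

Lemma lab_quad_phi x : x \in Defs.ds Q ->
  Defs.lab Q (quad_phi x) = Defs.lab Q (Defs.alpha Q x).
Proof.
case/quad_cases=> [[m [Dm ltm]]|[c [Dc eqc]]].
  have [Dx lx [E1 E2 E3 E4]] := quad_phi_simple Dm ltm; have h1 := lab1 Dm.
  have lr := labr Dm; by case=> ->; rewrite ?E1 ?E2 ?E3 ?E4 /= ?lx; lia.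
have [E1 E2] := quad_phi_confluent Dc eqc.
by case=> ->; rewrite ?E1 ?E2 /= ?labr ?eqc.
Qed.

Lemma labelled_quad_of_map : labelled_quad Q.
Proof.
have aQ x : x \in Defs.ds Q -> Defs.alpha Q x \in Defs.ds Q by rewrite !quad_dsE.
have pn4 x : x \in Defs.ds Q -> pn Q 4 x = x.
  by move=> Dx; rewrite /pn !iterS !quad_phiE quad_phi4.
split=> //.
- by move=> [c []] Dc; apply/eqP=> -[].
- by move=> [c b] _; rewrite /= negbK.
- by move=> x Dx; apply: quad_phi_ds; apply: aQ.
(* [rho] is [quad_phi] after an involution, and the fourth power of [quad_phi] is the identity. *)
- move=> [c b] [c' b'] Dx Dy E.
  rewrite -[LHS]/(quad_phi (c, ~~ b)) -[RHS]/(quad_phi (c', ~~ b')) in E.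
  have : quad_phi (quad_phi (quad_phi (quad_phi (c, ~~ b)))) = (c, ~~ b).
    by apply: quad_phi4; apply: (aQ (c, b)).
  rewrite [X in quad_phi (quad_phi (quad_phi X))]E quad_phi4; last exact: (aQ (c', b')).
  by case=> -> /(can_inj negbK) ->.
- move=> [c b] Dx; rewrite -[X in X = _]/(Defs.lab Q (quad_phi (c, ~~ b))).
  by rewrite lab_quad_phi ?(aQ (c, b)) //= negbK.
- by move=> x Dx; rewrite /pn !iterS !quad_phiE quad_phi2_neq.
- by move=> [c []] _ /=; lia.
Qed.


Let quadQ := labelled_quad_of_map.

Lemma desc_quad (x : dart Q) : desc x = x.2.
Proof. by case: x => c []; rewrite /desc /=; lia. Qed.

(* Clockwise around a vertex of the quadrangulation one meets the darts coming
   from the corners whose next smaller corner is [x], from the last one to the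
   first one, and then the dart [(x, true)]. *)
Lemma nextsel_quad_asc u k : u \in ds ->
  lab (iter k.+1 phi u) < lab u ->
  (forall j, (j <= k)%N -> lab u <= lab (iter j phi u)) ->
  @nextsel Q (u, false) = quad_phi (iter k.+1 phi u, false).
Proof.
(* Passing from [u] to [prevle u] lengthens the walk to [x]; its length is bounded, as a longer walk
   would repeat a corner of label at least [lab u]. *)
move En: (#|dart M| - k)%N => n; elim/ltn_ind: n u k En => n IHn u k En Du ltx leu.
have ltk : (k < #|dart M|)%N.
  rewrite ltnNge; apply/negP=> lek.
  have [k' ltk' E] := @iter_ltn_card _ phi k.+1 u _ erefl.
  by have := leu k'; rewrite -E leNgt ltx => /(_ (leq_trans (ltnW ltk') lek)).
set x := iter _ _ _ in ltx *; have Dx : x \in ds by apply: iter_in Du.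
have DQ c b : c \in ds -> (c, b) \in Defs.ds Q by rewrite quad_dsE.
have dx : @desc Q (x, true) by rewrite desc_quad.
have au : ~~ @desc Q (u, false) by rewrite desc_quad.
have Erho : Defs.rho Q (u, false) = quad_phi (u, true) by [].
have Da := phiVM Du; have EV := phiVK Du.
suff [de Er] : fconnect (Defs.rho Q) (u, false) (x, true) /\
    @nextsel Q (Defs.rho Q (u, false)) = quad_phi (x, false).
  by rewrite (nextsel_asc quadQ (DQ _ _ Du) au de dx).
(* Either the next dart clockwise is [(x, true)], or it is [(prevle u, false)], whose first smaller
   corner is again [x]. *)
have [lta|lea] := boolP (lab (phiV u) < lab u).
  have Ex : nextle (phiV u) = x.
    have Ej j : iter j.+1 phi (phiV u) = iter j phi u by rewrite iterSr EV.
    have lx : lab x <= lab (phiV u) by have := lab_phiV1 Du; lia.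
    rewrite /x -Ej; apply: first_return_eq; first by rewrite Ej.
    by move=> j ltj; rewrite Ej inE -ltNge (lt_le_trans lta) // leu.
  have E : Defs.rho Q (u, false) = (x, true) by rewrite Erho /= lta Ex.
  rewrite E; split; first by rewrite -E fconnect1.
  by rewrite (nextsel_desc quadQ) ?DQ.
rewrite -leNgt in lea; have [Dp lp lep np] := prevleP Du lea.
have [_ _ _ _ [j Ej Hj]] := nextleP Dp lep; rewrite np in Ej.
have Ei i : iter i phi u = iter (i + j.+1) phi (prevle u) by rewrite iterD -Ej.
have E : Defs.rho Q (u, false) = (prevle u, false) by rewrite Erho /= ltNge lea.
have -> : x = iter (k + j.+1).+1 phi (prevle u) by rewrite /x Ei addSn.
have IH : @nextsel Q (prevle u, false) = quad_phi (iter (k + j.+1).+1 phi (prevle u), false).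
  apply: (IHn (#|dart M| - (k + j.+1))%N) => //; first by lia.
    by rewrite -addSn -Ei lp.
  move=> i lei; rewrite lp; case: (leqP i j) => leij; first by rewrite -lp Hj.
  by rewrite -(subnK leij) -Ei leu //; lia.
rewrite E IH; split=> //.
apply: connect_trans (_ : fconnect (Defs.rho Q) (u, false) (prevle u, false)) _.
  by rewrite -E fconnect1.
rewrite -addSn -Ei -/x in IH *.
have DpQ := DQ _ false Dp; have DxQ := DQ _ true Dx.
have := nextsel_vertex DpQ; rewrite IH => H; apply: connect_trans H _.
rewrite (fconnect_rho_sym quadQ) //; last by apply: (rho_ds quadQ DxQ).
exact: (fconnect1 (Defs.rho Q) (x, true)).
Qed.

(** [quad_phi (c, false)] is the selected corner standing for the corner [c] of [M]; with
    [partner_quad], this identifies [Psi Q] with [M]. *)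
Lemma nextsel_quad c : c \in ds ->
  @nextsel Q (quad_phi (c, false)) = quad_phi (rho c, false).
Proof.
move=> Dc; rewrite {1}/quad_phi; case: ifPn => ltc.
  have E : iter 1 phi (alpha c) = rho c by rewrite /= /Defs.phi aK.
  rewrite (@nextsel_quad_asc (alpha c) 0) ?E ?aM ?labr //.
  by case.
by rewrite (nextsel_desc quadQ) ?desc_quad // quad_dsE /= rM.
Qed.

Lemma partner_quad c : c \in ds ->
  @partner Q (quad_phi (c, false)) = quad_phi (alpha c, false).
Proof.
move=> Dc; have DcQ : (c, false) \in Defs.ds Q by rewrite quad_dsE.
have Sc : quad_phi (c, false) \in sel_ds Q.
  by rewrite -quad_phiE; apply: (S_phi quadQ DcQ); rewrite desc_quad.
have DQ := S_ds Sc.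
have E3 : pn Q 3 (quad_phi (c, false)) = (c, false).
  by rewrite -quad_phiE; apply: (pn3_phi quadQ).
have E1 (x : dart Q) : pn Q 2 x = quad_phi (quad_phi x) by rewrite /pn !iterS !quad_phiE.
have := selP quadQ DQ (S_sel Sc); rewrite E3 E1 quad_phiE.
case: (ltgtP (lab (alpha c)) (lab c)) => ltc.
- have [Dx lx [-> -> -> ->]] := quad_phi_simple Dc ltc.
  by rewrite /= labr // lx; case=> -[-> q1 q2 q3] //; lia.
- have Da := aM Dc; have := @quad_phi_simple (alpha c) Da; rewrite aK // => /(_ ltc).
  move=> [Dx lx [E5 E6 E7 ->]]; rewrite E5 E6 /= lx labr //.
  by case=> -[-> q1 q2 q3] //; lia.
- have [-> ->] := quad_phi_confluent Dc ltc.
  have [Da eqa] := confluent_swap Dc ltc.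
  have [-> _] := quad_phi_confluent Da eqa.
  by rewrite /= !labr // ltc; case=> -[-> q1 q2 q3] //; lia.
Qed.

Definition quad_corner (d : dart Q) : dart M := (pn Q 3 d).1.

Lemma S_quadP d : reflect (exists2 c, c \in ds & d = quad_phi (c, false)) (d \in sel_ds Q).
Proof.
apply: (iffP idP) => [Sd|[c Dc ->]].
  have Dd := S_ds Sd; exists (quad_corner d).
    by have := pn_ds quadQ 3 Dd; rewrite quad_dsE.
  have := asc_pn3 quadQ Sd; rewrite desc_quad /quad_corner.
  rewrite -[LHS](phi_pn3 quadQ Dd) quad_phiE.
  by case: (pn Q 3 d) => c' [].
rewrite -quad_phiE; apply: (S_phi quadQ); rewrite ?desc_quad //.
by rewrite quad_dsE.
Qed.

Lemma quad_cornerK c : c \in ds -> quad_corner (quad_phi (c, false)) = c.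
Proof.
by move=> Dc; rewrite /quad_corner -quad_phiE (pn3_phi quadQ) ?quad_dsE.
Qed.

Lemma iso_quad_corner : @iso_core (Psi Q) M quad_corner.
Proof.
split; first by move=> _ /S_quadP[c Dc ->]; rewrite quad_cornerK.
split.
  move=> _ _ /S_quadP[c Dc ->] /S_quadP[c' Dc' ->].
  by rewrite !quad_cornerK // => ->.
split.
  move=> c Dc; exists (quad_phi (c, false)); last exact: quad_cornerK.
  by apply/S_quadP; exists c.
split.
  move=> _ /S_quadP[c Dc ->]; rewrite [Defs.alpha _ _]partner_quad //.
  by rewrite !quad_cornerK ?aM.
split.
  move=> _ /S_quadP[c Dc ->]; rewrite [Defs.rho _ _]nextsel_quad //.
  by rewrite !quad_cornerK ?rM.
move=> _ /S_quadP[c Dc ->]; rewrite quad_cornerK //.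
by rewrite -[RHS]/(Defs.lab Q (quad_phi (c, false))) lab_quad_phi // quad_dsE.
Qed.

Lemma quad_corner_root : rootd M \in ds ->
  quad_corner (psi_root Q) = rootd M.
Proof.
move=> r; rewrite (psi_rootE quadQ) ?quad_dsE //.
have -> : root_desc Q = (rootd M, true) by rewrite /root_desc desc_quad.
exact: quad_cornerK.
Qed.

(** Between base darts [(c, false)], an [alpha] step of [M] is followed around the face of its edge,
    and a [rho] step around a vertex of [Q]. *)
Lemma connected_quad :
  {in ds &, forall d e, connect (@dart_step M) d e} ->
  {in Defs.ds Q &, forall d e, connect (@dart_step Q) d e}.
Proof.
move=> conM.
have cona (x : dart Q) : connect (@dart_step Q) x (Defs.alpha Q x).
  by apply: connect1; rewrite /dart_step eqxx.
have conr (x : dart Q) : connect (@dart_step Q) x (Defs.rho Q x).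
  by apply: connect1; rewrite /dart_step eqxx orbT.
have conp (x : dart Q) : connect (@dart_step Q) x (quad_phi x).
  by rewrite -quad_phiE; apply: connect_trans (cona _) (conr _).
have conv (x y : dart Q) : fconnect (Defs.rho Q) x y -> connect (@dart_step Q) x y.
  by apply: connect_sub => z _ /eqP <-.
have main c c' : c \in ds -> connect (@dart_step M) c c' ->
    connect (@dart_step Q) (c, false) (c', false).
  move=> Dc /connectP[p]; elim: p c Dc => [|e p IHp] c Dc /=.
    by move=> _ ->; apply: connect0.
  case/andP=> ce ep last_p.
  have De : e \in ds by case/orP: ce => /eqP ->; rewrite ?aM ?rM.
  apply: connect_trans (IHp e De ep last_p).
  case/orP: ce => /eqP ->.
    case: (ltgtP (lab (alpha c)) (lab c)) => ltc.
    - have [_ _ [E1 E2 E3 E4]] := quad_phi_simple Dc ltc.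
      by rewrite -E3 -E2 -E1; do 2!apply: connect_trans (conp _) _.
    - by apply: connect_trans (conp _) _; rewrite /quad_phi ltc.
    - have [E1 E2] := quad_phi_confluent Dc ltc.
      by rewrite -E2 -E1; apply: connect_trans (conp _) _.
  have S1 : quad_phi (c, false) \in sel_ds Q by apply/S_quadP; exists c.
  have step1 := connect_trans (conp (c, false)) (conv _ _ (nextsel_vertex (S_ds S1))).
  apply: connect_trans step1 _; rewrite nextsel_quad //.
  have S2 : quad_phi (rho c, false) \in sel_ds Q by apply/S_quadP; exists (rho c); rewrite ?rM.
  have := conv _ _ (fconnect_rinv quadQ (S_ds S2)).
  rewrite (_ : @rinv Q _ = (rho c, true)).
    by move=> H; apply: connect_trans H (cona (rho c, true)).
  rewrite /rinv -quad_phiE (pn3_phi quadQ) // quad_dsE /= ?rM //.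
move=> [c b] [c' b']; rewrite !quad_dsE /= => Dc Dc'.
have /(main _ _ Dc) H := conM _ _ Dc Dc'.
apply: connect_trans (_ : connect (@dart_step Q) (c, b) (c, false)) _.
  by case: b => //; apply: (cona (c, true)).
apply: connect_trans H _.
by case: b' => //; apply: (cona (c', false)).
Qed.

End Inverse.

Lemma Psi_surjective M : isMl M -> exists2 Q : lmap, isQl Q & isoM (Psi Q) M.
Proof.
case=> -[rootM [aM' [rM [rI [conM eulerM]]]]] [labr lab1].
have aM : {in ds M, forall d, alpha M d \in ds M} by move=> d /aM'[].
have aneq : {in ds M, forall d, alpha M d != d} by move=> d /aM'[? []].
have aK : {in ds M, involutive (alpha M)} by move=> d /aM'[? []].
have quadQ := labelled_quad_of_map aM aneq aK rM rI labr lab1.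
have iso := iso_quad_corner aM aneq aK rM rI labr lab1.
exists (quad_of_map M); last first.
  exists (@quad_corner M); split=> //.
  exact: (quad_corner_root aM aneq aK rM rI labr lab1).
have [fD [fI [fS [fa [fr fl]]]]] := iso.
have phiD : {homo @phi M : d / d \in ds M} by move=> d Dd; rewrite rM ?aM.
have fphi c : c \in sel_ds (quad_of_map M) ->
    quad_corner (@phi (Psi (quad_of_map M)) c) = phi (quad_corner c).
  by move=> Sc; rewrite /phi fr ?fa //; apply: (partner_S quadQ Sc).
split; last first.
  split; first exact (lab_rho quadQ).
  split; first exact (card_face quadQ).
  exact (lab_alpha quadQ).
split; first by rewrite inE.
split.
  move=> d Dd; split; first exact (alpha_ds quadQ Dd).
  by split; [exact (alpha_neq quadQ Dd) | exact (alphaK quadQ Dd)].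
split; first exact (rho_ds quadQ).
split; first exact (rho_inj quadQ).
split; first exact (connected_quad aM aneq aK rM rI labr lab1 conM).
(* Euler's formula passes from [M] to the isomorphic image under [Psi], and from there to the
   quadrangulation. *)
apply/(euler_Psi quadQ).
have -> : nverts (Psi (quad_of_map M)) = nverts M.
  exact (norb_iso (nextsel_in_S quadQ) (nextsel_inj quadQ) rM rI fD fI fS fr).
have -> : nedges (Psi (quad_of_map M)) = nedges M.
  have aI : {in ds M &, injective (alpha M)} by apply: can_in_inj aK.
  exact (norb_iso (partner_S quadQ) (partner_inj quadQ) aM aI fD fI fS fa).
have -> // : nfaces (Psi (quad_of_map M)) = nfaces M.
exact (norb_iso (phiP_S quadQ) (phiP_inj quadQ) phiD (phi_inj_map aM aK rI) fD fI fS fphi).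
Qed.

Theorem theorem1 :
  (forall Q : lmap, isQl Q ->
     isMl (Psi Q) /\
     (* (i) *) nedges (Psi Q) = nfaces Q /\
     (* (ii) *) nfaces (Psi Q) = nlocmin Q /\
     (* (iii) *) nlocmax (Psi Q) = nlocmax Q /\
     {in ds Q, forall d, @locmax Q d <->
        exists2 e, e \in ds (Psi Q) & (e \in @vert Q d) && @locmax (Psi Q) e} /\
     (* (iv) *) maxlab (Psi Q) = maxlab Q /\
     (* (v) *) minlab (Psi Q) = minlab Q + 1 /\
     (* (vi) *) lab (Psi Q) (rootd (Psi Q)) =
                Order.max (lab Q (rootd Q)) (lab Q (alpha Q (rootd Q)))) /\
  (* Psi is well defined on isomorphism classes and injective *)
  (forall Q1 Q2 : lmap, isQl Q1 -> isQl Q2 ->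
     (isoQ Q1 Q2 <-> isoM (Psi Q1) (Psi Q2))) /\
  (* Psi is surjective onto M^(l) *)
  (forall M : lmap, isMl M -> exists2 Q : lmap, isQl Q & isoM (Psi Q) M).
Proof.
split; last by split; [exact: isoQ_isoM_Psi | exact: Psi_surjective].
move=> Q isQ; have quadQ := isQl_labelled_quad isQ.
have [[rootQ [_ [_ [_ [conQ eulerQ]]]]] _] := isQ.
split; first exact (isMl_Psi quadQ rootQ conQ eulerQ).
split; first exact: nedges_Psi.
split; first exact: nfaces_Psi.
split; first exact: nlocmax_Psi.
split; first exact (locmax_Psi_vertex quadQ).
split; first exact: maxlab_Psi.
split; first exact: minlab_Psi.
exact (lab_psi_root quadQ rootQ).
Qed.
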